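(* Let $T$ be a Calderón–Zygmund singular integral operator on $\mathbb{R}^n$ (so that $T$ maps $H^1(\mathbb{R}^n)$ boundedly into $L^1(\mathbb{R}^n)$ and $L^1(\mathbb{R}^n)$ boundedly into weak $L^1$, that is, into $L^{1,\infty}(\mathbb{R}^n)$). Then $T$ maps $X_s(\mathbb{R}^n)$ into the Lorentz space $L^{1,r}(\mathbb{R}^n)$ whenever $1<s<r\le\infty$.
   Context: For $1<q\le 2$ with conjugate exponent $2\le p<\infty$, $1/p+1/q=1$, and $0<s\le\infty$ (with $1/\infty=0$), a compactly supported function $a$ on $\mathbb{R}^n$ is a $(q,s)$ atom with defining cube $Q$ if $\mathrm{supp}(a)\subseteq Q$, $\int_Q a(x)\,dx=0$, and $$p^{1/s}\,|Q|\left(\frac1{|Q|}\int_Q|a(x)|^q\,dx\right)^{1/q}\le 1 .$$ $\mathcal{A}_s$ denotes the collection of all $(q,s)$ atoms, over all $1<q\le 2$ and all cubes $Q$; it is contained in the unit ball of $L^1(\mathbb{R}^n)$. The space $X_s=X_s(\mathbb{R}^n)$ consists of all $f\in L^1(\mathbb{R}^n)$ of the form $f=\sum_j\lambda_j a_j$ (convergence in $L^1$) with $a_j\in\mathcal{A}_s$ and $\sum_j|\lambda_j|<\infty$, normed by $\|f\|_{X_s}=\inf\sum_j|\lambda_j|$, the infimum being over all such decompositions of $f$. $H^1(\mathbb{R}^n)$ is the (real) Hardy space. $L^{1,r}$ is the Lorentz space on $\mathbb{R}^n$, with $\|g\|_{1,r}=\big(\int_0^\infty (t\,g^*(t))^r\,dt/t\big)^{1/r}$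 for $r<\infty$ and $\|g\|_{1,\infty}=\sup_{t>0}t\,g^*(t)$, $g^*$ being the decreasing rearrangement of $g$. *)

(* Defs.v *)
From HB Require Import structures.
From mathcomp Require Import all_boot all_order all_algebra.
From mathcomp Require Import all_classical all_reals all_analysis.

Set Implicit Arguments.
Unset Strict Implicit.
Unset Printing Implicit Defensive.

Import Order.TTheory GRing.Theory Num.Theory.
Import numFieldNormedType.Exports.

Local Open Scope classical_set_scope.
Local Open Scope ring_scope.

(* R^n with the product (i.e. Borel) sigma-algebra of the library's tuples. *)
Notation Rn R n := (n.-tuple (measurableTypeR R)).

Section tuple_measure.
Context (R : realType) (n : nat).
Variable mu : {sigma_finite_measure set (Rn R n) -> \bar R}.

Definition consp (z : measurableTypeR R * Rn R n) : Rn R n.+1 :=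
  [the n.+1.-tuple (measurableTypeR R) of z.1 :: z.2].

Lemma measurable_consp : measurable_fun [set: measurableTypeR R * Rn R n] consp.
Proof. exact: measurable_cons. Qed.

(* The product of one-dimensional Lebesgue measure and mu, carried over to
   (n+1)-tuples by (x, t) |-> x :: t. *)
Definition cons_measure : set (Rn R n.+1) -> \bar R :=
  pushforward (@lebesgue_measure R \x mu)%E consp.

Let cons_measure0 : cons_measure set0 = 0%E.
Proof. by rewrite /cons_measure /pushforward preimage_set0 measure0. Qed.

Let cons_measure_ge0 A : (0 <= cons_measure A)%E.
Proof. by rewrite /cons_measure /pushforward measure_ge0. Qed.

Let cons_measure_sigma_additive : semi_sigma_additive cons_measure.
Proof.
move=> F mF tF mUF; rewrite /cons_measure /pushforward preimage_bigcup.
apply: measure_semi_sigma_additive.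
- by move=> k; rewrite -[X in measurable X]setTI; exact: measurable_consp.
- apply/trivIsetP => i j _ _ ij; rewrite -preimage_setI.
  by move/trivIsetP : tF => /(_ _ _ _ _ ij) ->//; rewrite preimage_set0.
- by rewrite -preimage_bigcup -[X in measurable X]setTI; exact: measurable_consp.
Qed.

HB.instance Definition _ := isMeasure.Build _ _ _ cons_measure
  cons_measure0 cons_measure_ge0 cons_measure_sigma_additive.

Lemma cons_measure_sigma_finite : sigma_finite [set: Rn R n.+1] cons_measure.
Proof.
have /sigma_finiteP[F [FT ndF Foo]] := sigma_finiteT (@lebesgue_measure R).
have /sigma_finiteP[G [GT ndG Goo]] := sigma_finiteT mu.
pose g (x : Rn R n.+1) : measurableTypeR R * Rn R n :=
  (thead x, [tuple of behead x]).
have mg : measurable_fun [set: Rn R n.+1] g.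
  by apply: measurable_fun_pair; [exact: measurable_tnth|exact: measurable_behead].
have gK z : g (consp z) = z.
  by case: z => x t; rewrite /g /consp/= theadE; congr pair; exact: val_inj.
exists (fun i => g @^-1` (F i `*` G i)).
  apply/esym; rewrite -subTset => x _.
  have [i _ Fi] : (\bigcup_i F i) (g x).1 by rewrite -FT.
  have [j _ Gj] : (\bigcup_i G i) (g x).2 by rewrite -GT.
  exists (maxn i j) => //; split.
  - by move: Fi; exact/subsetPset/ndF/leq_maxl.
  - by move: Gj; exact/subsetPset/ndG/leq_maxr.
move=> i; have [mF Fi] := Foo i; have [mG Gi] := Goo i; split.
  by rewrite -[X in measurable X]setTI; apply: mg => //; exact: measurableX.
rewrite /cons_measure /pushforward (_ : consp @^-1` _ = F i `*` G i).
  by rewrite product_measure1E// lte_mul_pinfty// ge0_fin_numE.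
rewrite -comp_preimage (_ : g \o consp = id)//; exact/funext.
Qed.

HB.instance Definition _ :=
  Measure_isSigmaFinite.Build _ _ _ cons_measure cons_measure_sigma_finite.

End tuple_measure.

(* Lebesgue measure on R^n, as the n-fold product. *)
Fixpoint lebn (R : realType) (n : nat) :
    {sigma_finite_measure set (Rn R n) -> \bar R} :=
  match n with
  | 0%N => dirac ([tuple] : Rn R 0)
  | m.+1 => cons_measure (lebn R m)
  end.

Lemma measurable_box (R : realType) n (A : 'I_n -> set (measurableTypeR R)) :
  (forall i, measurable (A i)) ->
  measurable [set x : Rn R n | forall i, A i (tnth x i)].
Proof.
move=> mA.
have -> : [set x : Rn R n | forall i, A i (tnth x i)] =
    \bigcap_(i in [set: 'I_n]) ((fun x : Rn R n => tnth x i) @^-1` A i).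
  by apply/seteqP; split => x /= xA i; [move=> _|]; exact: xA.
apply: fin_bigcap_measurable => // i _.
by rewrite -[X in measurable X]setTI; exact: measurable_tnth.
Qed.

Lemma lebn_box (R : realType) n (A : 'I_n -> set (measurableTypeR R)) :
  (forall i, measurable (A i)) ->
  lebn R n [set x | forall i, A i (tnth x i)] =
  (\prod_(i < n) lebesgue_measure (A i))%E.
Proof.
elim: n A => [|n IHn] A mA.
  by rewrite big_ord0 /= diracE mem_set// => -[].
rewrite big_ord_recl -IHn// -product_measure1E//; last first.
  exact: (@measurable_box R n (fun i => A (lift ord0 i))).
rewrite /= /cons_measure /pushforward; congr (product_measure1 _ _ _).
apply/seteqP; split => -[x t] /=.
  by move=> xtA; split => [|i]; [exact: (xtA ord0)|rewrite -(tnthS x); exact: xtA].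
move=> [xA tA] i; case: (unliftP ord0 i) => [j|] ->.
  by rewrite tnthS; exact: tA.
by rewrite tnth0.
Qed.

Section euclidean.
Context (R : realType) (n : nat).
Implicit Types (x y c : Rn R n) (f : Rn R n -> R) (l : R).

Definition eucl_dist x y : R := Num.sqrt (\sum_(i < n) (tnth x i - tnth y i) ^+ 2).

(* Closure of {f <> 0}. *)
Definition supp f : set (Rn R n) :=
  [set x | forall e : R, 0 < e -> exists2 y, eucl_dist x y < e & f y != 0].

Definition compactly_supported f :=
  exists M : R, forall x y, supp f x -> supp f y -> eucl_dist x y <= M.

Definition cube c l : set (Rn R n) :=
  [set x | forall i, tnth c i <= tnth x i <= tnth c i + l].

End euclidean.

Section spaces.
Context (R : realType) (n : nat).
Local Notation mu := (lebn R n).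
Implicit Types (f g a : Rn R n -> R) (s r : \bar R).

(* Here p is the exponent conjugate to q. For s = +oo, fine s^-1 = 0. *)
Definition atom_on (p q : R) s a (c : Rn R n) (l : R) : Prop :=
  let Q := cube c l in
  let vol := fine (mu Q) in
  [/\ measurable_fun [set: Rn R n] a,
      supp a `<=` Q,
      \int[mu]_(x in Q) a x = 0 &
      ((p `^ fine s^-1 * vol)%:E *
       ((vol^-1)%:E * \int[mu]_(x in Q) (`|a x| `^ q)%:E) `^ q^-1 <= 1)%E].

Definition atom s a : Prop :=
  exists p q : R, [/\ 1 < q <= 2, p^-1 + q^-1 = 1 &
    exists c l, 0 < l /\ atom_on p q s a c l].

Definition Xs s : set (Rn R n -> R) :=
  [set f | f \in Lfun mu 1%E /\
    exists (lam : nat -> R) (a : nat -> Rn R n -> R),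
      [/\ forall j, atom s (a j),
          (\sum_(0 <= j <oo) `|lam j|%:E < +oo)%E &
          'N[mu]_1%E[EFin \o (fun x => f x - \sum_(j < N) lam j * a j x)%R]%E
            @[N --> \oo] --> 0%E]].

(* Decreasing rearrangement; the infimum of the empty set is +oo. *)
Definition rearrangement g (t : R) : \bar R :=
  ereal_inf [set lam%:E | lam in
    [set lam : R | 0 <= lam /\ (mu [set x | (lam < `|g x|)%R] <= t%:E)%E]].

Definition lorentz1 r g : \bar R :=
  match r with
  | r%:E => (\int[@lebesgue_measure R]_(t in `]0%R, +oo[)
      ((t%:E * rearrangement g t) `^ r * (t^-1)%:E)) `^ r^-1
  | +oo => ereal_sup [set t%:E * rearrangement g t | t in `]0%R, +oo[]
  | -oo => +oo
  end%E.

Definition Lorentz1 r : set (Rn R n -> R) :=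
  [set g | measurable_fun [set: Rn R n] g /\ (lorentz1 r g < +oo)%E].

(* Calderon-Zygmund kernels: size bound and Hormander's smoothness condition.
   The latter holds for the kernels with Hoelder or Dini regularity, and it is
   the only regularity required. The values on the diagonal are irrelevant. *)
Definition CZ_kernel (K : Rn R n -> Rn R n -> R) : Prop :=
  measurable_fun [set: Rn R n * Rn R n] (fun z => K z.1 z.2) /\
  exists A : R,
    (forall x y, x <> y -> `|K x y| <= A / eucl_dist x y ^+ n) /\
    (forall y y', (\int[mu]_(x in [set x | (2 * eucl_dist y y' <= eucl_dist x y)%R])
                      `|(K x y - K x y')%R|%:E <= A%:E)%E).

(* Real-linearity of T on the subspace D, modulo null sets. *)
Definition ae_linear_on (D : {pred Rn R n -> R})
    (T : (Rn R n -> R) -> Rn R n -> R) : Prop :=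
  forall (k : R) f g, f \in D -> g \in D ->
    T (fun x => k * f x + g x) = (fun x => k * T f x + T g x) %[ae mu].

(* T acts on representatives. On L^2 it is a bounded operator given off the
   support by the kernel. On L^1 it is the extension that is bounded into weak
   L^1; boundedness and linearity make T f well defined up to null sets, and
   the agreement with the L^2 operator on the dense subspace of L^1 /\ L^2
   determines it. *)
Definition CZ_operator (T : (Rn R n -> R) -> Rn R n -> R) : Prop :=
  [/\ ae_linear_on (Lfun mu 2%:E) T,
      exists C : R, forall f, f \in Lfun mu 2%:E ->
        measurable_fun [set: Rn R n] (T f) /\
        ('N[mu]_2%:E[EFin \o T f] <= C%:E * 'N[mu]_2%:E[EFin \o f])%E,
      exists2 K, CZ_kernel K & forall f, f \in Lfun mu 2%:E ->
        compactly_supported f ->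
        {ae mu, forall x, ~ supp f x -> T f x = \int[mu]_y (K x y * f y)},
      ae_linear_on (Lfun mu 1%E) T &
      exists C : R, forall f, f \in Lfun mu 1%E ->
        measurable_fun [set: Rn R n] (T f) /\
        (lorentz1 +oo (T f) <= C%:E * 'N[mu]_1%E[EFin \o f])%E].

End spaces.

(* Main.v *)
Require Import Defs.
From mathcomp Require Import all_boot all_order all_algebra.
From mathcomp Require Import all_classical all_reals all_analysis.
From mathcomp Require Import measurable_realfun ring lra.

(** Let C denote constants depending on T, n, s only.

    The case r = +oo is the weak type (1,1) of T. For s < r < +oo the proof is
    an interpolation between L^1 and weak L^1, made by hand.

    A (q,s) atom a on a cube Q has L^1 norm at most C p^(-1/s), and T a is
    essentially in L^1 with norm at most C p^(1 - 1/s). For the second bound, T is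
    of weak type (q,q) with a constant independent of 1 < q <= 2 ([CZ_weakqq]), so
    on a dilate of Q summing over level sets costs a factor 1/(q - 1), which is at
    most p ([weak_integral_le]); off that dilate the cancellation of a and the
    Hormander condition give an L^1 bound ([CZ_far]). Both are combined in
    [CZ_molecule]. Since the kernel represents T only on L^2, atoms are first
    truncated to bounded functions of mean zero ([truncation]); the error is as
    small in L^1 as desired, and no limit of T has to be taken.

    Given delta > 0, replacing by 0 the atoms with p^(-1/s) <= delta and truncating
    the others splits f in X_s into a finite sum f1 with T f1 in L^1, of norm at
    most C delta^(1 - s), and a remainder f - f1 of L^1 norm at most C delta
    ([atom_split], [Xs_split]), with constants that now also depend on f. The
    remainder contributes at most C delta to t (T f)^*(t). Choosing delta
    proportional to a, the set where t (T f)^*(t) > a has dt/t-measure at most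
    C/a times the L^1 norm of T f1, that is C a^(-s). So the function
    t |-> t (T f)^*(t), which is bounded, lies in weak L^s(dt/t), hence in
    L^r(dt/t) because s < r ([lorentz1_lty]). *)

Set Implicit Arguments.
Unset Strict Implicit.
Unset Printing Implicit Defensive.

Import Order.TTheory GRing.Theory Num.Theory.
Import numFieldNormedType.Exports.

Local Open Scope classical_set_scope.
Local Open Scope ring_scope.

(** * Geometric levels and series *)

Section series.
Context (R : realType).
Local Open Scope ereal_scope.

Lemma nneseries_geometric_le (c q : R) : (0 <= c)%R -> (0 <= q < 1)%R ->
  \sum_(0 <= k <oo) (c * q ^+ k)%:E <= (c / (1 - q))%:E.
Proof.
move=> c0 /andP[q0 q1]; apply: lime_le.
  by apply: is_cvg_nneseries => k _ _; rewrite lee_fin mulr_ge0// exprn_ge0.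
apply: nearW => m; rewrite sumEFin lee_fin -mulr_sumr ler_wpM2l//.
rewrite -[leRHS]mul1r ler_pdivlMr ?subr_gt0// mulrC big_mkord.
rewrite -opprB mulNr -subrX1 opprB gerBl exprn_ge0//.
Qed.

Lemma nneseries_ge_term (u : nat -> \bar R) k : (forall i, 0 <= u i) ->
  u k <= \sum_(0 <= i <oo) u i.
Proof.
move=> u0; apply: le_trans (nneseries_lim_ge k.+1 _) => //.
by rewrite big_nat_recr//= leeDr// sume_ge0.
Qed.

Lemma cvg0_ex_le (u : nat -> \bar R) (e : R) :
  u @ \oo --> 0 -> (0 < e)%R -> exists k, u k <= e%:E.
Proof.
move=> /fine_cvgP[ufin /cvgr_lt ult] e0.
near \oo => k; exists k.
have uk : u k \is a fin_num by near: k.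
rewrite -(fineK uk) lee_fin ltW//; near: k; exact: ult.
Unshelve. all: by end_near.
Qed.

Lemma geometric_level (q M h : R) : (0 < q < 1)%R -> (0 < h <= M)%R ->
  exists k, (M * q ^+ k.+1 < h <= M * q ^+ k)%R.
Proof.
move=> /andP[q0 q1] /andP[h0 hM].
have [m hm] : exists m, (M * q ^+ m < h)%R.
  have /cvgr_lt /(_ _ h0) [m _ /(_ m (leqnn m)) /= hm] :
      (fun m => M * q ^+ m)%R @ \oo --> (0%R : R).
    by apply: cvg_geometric; rewrite gtr0_norm.
  by exists m.
elim: m hm => [|m IHm] hm; first by move: hm; rewrite expr0 mulr1 ltNge hM.
by have [/IHm//|hm'] := ltP (M * q ^+ m)%R h; exists m; rewrite hm hm'.
Qed.

Lemma invr_1sub_expRN_le (x : R) : (0 < x <= 1)%R -> ((1 - expR (- x))^-1 <= 2 / x)%R.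
Proof.
move=> /andP[x0 x1]; rewrite -[(2 / x)%R]invrK invf_div.
have e0 := expR_gt0 x; have ex := expR_ge1Dx x.
have : (expR (- x) <= (1 + x)^-1)%R by rewrite expRN lef_pV2 ?posrE ?addr_gt0.
have : ((1 + x)^-1 <= 1 - x / 2)%R.
  by rewrite -[leLHS]mul1r ler_pdivrMr ?addr_gt0//; nra.
move=> h1 h2; rewrite lef_pV2 ?posrE ?divr_gt0//; first lra.
by rewrite subr_gt0 (le_lt_trans h2)// invf_lt1 ?addr_gt0// ltrDl.
Qed.

End series.

(** * Integrals and level sets *)

Section integrals.
Context d (T : measurableType d) (R : realType) (mu : {measure set T -> \bar R}).
Implicit Types f g h : T -> R.
Local Open Scope ereal_scope.

(** The integral of a nonnegative function is a supremum over the simple functions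
    below it, hence monotone for arbitrary functions; here the integrands will be
    powers of the decreasing rearrangement. *)
Lemma le_integral_nonmeasurable (D : set T) (f g : T -> \bar R) :
  (forall x, D x -> 0 <= f x <= g x) ->
  \int[mu]_(x in D) f x <= \int[mu]_(x in D) g x.
Proof.
move=> fg; rewrite !ge0_integralE; last 2 first.
- by move=> x /fg /andP[f0 fg']; exact: le_trans fg'.
- by move=> x /fg /andP[].
apply: le_ereal_sup => _ [h hf <-]; exists h => // x.
apply: (le_trans (hf x)); rewrite /patch; case: ifPn => // /set_mem Dx.
by case/andP: (fg _ Dx).
Qed.

Lemma integral_le_scale (D : set T) f g (k : R) : measurable D ->
  measurable_fun D g -> (0 <= k)%R ->
  (forall x, D x -> 0 <= g x)%R -> (forall x, D x -> 0 <= f x <= k * g x)%R ->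
  \int[mu]_(x in D) (f x)%:E <= k%:E * \int[mu]_(x in D) (g x)%:E.
Proof.
move=> mD mg k0 g0 fg; rewrite -ge0_integralZl//.
- by apply: le_integral_nonmeasurable => x /fg; rewrite -EFinM !lee_fin.
- exact/measurable_EFinP.
Qed.

Lemma integral_comb_le (k : R) f g h (A B : \bar R) :
  measurable_fun setT f -> measurable_fun setT g -> measurable_fun setT h ->
  h = (fun x => k * f x + g x)%R %[ae mu] ->
  \int[mu]_x `|f x|%:E <= A -> \int[mu]_x `|g x|%:E <= B ->
  \int[mu]_x `|h x|%:E <= `|k|%:E * A + B.
Proof.
move=> mf mg mh hE fA gB.
have mf' : measurable_fun setT (fun x => `|f x|%:E).
  by apply/measurable_EFinP; exact: measurableT_comp.
have mg' : measurable_fun setT (fun x => `|g x|%:E).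
  by apply/measurable_EFinP; exact: measurableT_comp.
apply: (@le_trans _ _ (\int[mu]_x (`|k|%:E * `|f x|%:E + `|g x|%:E))).
  apply: ae_ge0_le_integral => //.
  - by apply/measurable_EFinP; exact: measurableT_comp.
  - by move=> x _; rewrite adde_ge0// mule_ge0.
  - by apply: emeasurable_funD => //; exact: measurable_funeM.
  - apply: filterS hE => x /= + xT => /(_ xT) ->.
    by rewrite -EFinM -EFinD lee_fin -normrM ler_normD.
rewrite ge0_integralD//; last exact: measurable_funeM.
by rewrite ge0_integralZl// leeD// lee_wpmul2l// lee_fin.
Qed.

Lemma measurable_normr_powR f (q : R) : measurable_fun [set: T] f ->
  measurable_fun [set: T] (fun x => `|f x| `^ q)%R.
Proof.
move=> mf; apply: (measurableT_comp (measurable_powR _)).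
exact: measurableT_comp.
Qed.

Lemma Lfun1P f : measurable_fun [set: T] f ->
  \int[mu]_x `|f x|%:E < +oo -> f \in Lfun mu 1.
Proof.
by move=> mf If; apply/Lfun1_integrable/integrableP; split => //; exact/measurable_EFinP.
Qed.

Lemma Lfun1_cst0 : (fun=> 0%R) \in Lfun mu 1.
Proof.
by apply: Lfun1P => //; rewrite integral0_eq// => x _; rewrite normr0.
Qed.

Lemma Lfun1_mfun f : f \in Lfun mu 1 -> measurable_fun [set: T] f.
Proof. by move=> /Lfun1_integrable/integrableP[/measurable_EFinP]. Qed.

Lemma Lfun1_lty f : f \in Lfun mu 1 -> \int[mu]_x `|f x|%:E < +oo.
Proof. by move=> /Lfun1_integrable/integrableP[]. Qed.

Lemma Lfun2P f : measurable_fun [set: T] f ->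
  \int[mu]_x (`|f x| `^ 2)%:E < +oo -> f \in Lfun mu 2%:E.
Proof.
move=> mf If; apply/andP; split; rewrite inE//= /finite_norm unlock.
exact: poweR_lty.
Qed.

Lemma measurable_lt_set f g :
  measurable_fun [set: T] f -> measurable_fun [set: T] g ->
  measurable [set x | (f x < g x)%R].
Proof.
move=> mf mg; rewrite -[X in measurable X]setTI.
exact: (@measurable_fun_ltr _ _ _ setT f g).
Qed.

Lemma measurable_level f (l : R) :
  measurable_fun [set: T] f -> measurable [set x | (l < `|f x|)%R].
Proof. by move=> mf; apply: measurable_lt_set => //; exact: measurableT_comp. Qed.

Lemma level_le_integral f (l : R) :
  measurable_fun [set: T] f -> (0 < l)%R ->
  l%:E * mu [set x | (l < `|f x|)%R] <= \int[mu]_x `|f x|%:E.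
Proof.
move=> mf l0; have mA := measurable_level l mf.
rewrite -(setIT [set x | _]) -integral_indic// -ge0_integralZl//; last 2 first.
- exact/measurable_EFinP/measurable_indic.
- by rewrite lee_fin ltW.
apply: ge0_le_integral => //.
- by move=> x _; rewrite -EFinM lee_fin mulr_ge0// ltW.
- apply: measurable_funeM => //; exact/measurable_EFinP/measurable_indic.
- by apply/measurable_EFinP; exact: measurableT_comp.
- move=> x _; rewrite -EFinM lee_fin indicE; case: (boolP (_ \in _)).
    by rewrite inE/= mulr1 => /ltW.
  by rewrite mulr0.
Qed.

Lemma level_add g g1 g2 (l : R) :
  measurable_fun [set: T] g -> measurable_fun [set: T] g1 ->
  measurable_fun [set: T] g2 -> g = (fun x => g1 x + g2 x)%R %[ae mu] ->
  mu [set x | (l < `|g x|)%R] <=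
  mu [set x | (l / 2 < `|g1 x|)%R] + mu [set x | (l / 2 < `|g2 x|)%R].
Proof.
move=> mg mg1 mg2 [N [mN N0 gN]].
have m1 := measurable_level (l / 2) mg1; have m2 := measurable_level (l / 2) mg2.
apply: (@le_trans _ _ (mu (([set x | (l / 2 < `|g1 x|)%R] `|`
    [set x | (l / 2 < `|g2 x|)%R]) `|` N))).
  apply: le_measure; rewrite ?inE; [exact: measurable_level| |].
    by apply: measurableU => //; exact: measurableU.
  move=> x /= lx; have [Nx|Nx] := pselect (N x); first by right.
  left; have gx : g x = (g1 x + g2 x)%R.
    by apply: contrapT => gx; apply: Nx; apply: gN => /= /(_ Logic.I).
  move: lx; rewrite gx => lx; apply: contrapT => /not_orP[/negP + /negP].
  rewrite -!leNgt => h1 h2.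
  by have := lt_le_trans lx (ler_normD (g1 x) (g2 x)); lra.
rewrite (le_trans (measureU2 _ _ _))//; first exact: measurableU.
by rewrite [X in _ + X]N0 adde0 (le_trans (measureU2 _ _ _)).
Qed.

(** On a set of finite measure, a weak L^q bound gives an L^1 bound with loss
    1/(q - 1): beyond 2 N, the function |g| is dominated by the sum of the
    indicators of its level sets at the heights N e^k, weighted by 2 N e^(k+1),
    and the resulting geometric series has ratio e^(1 - q). *)
Lemma weak_integral_le g (E : set T) (q N B : R) :
  measurable_fun [set: T] g -> measurable E -> (1 < q <= 2)%R -> (0 < N)%R ->
  (0 <= B)%R ->
  (forall l : R, (0 < l)%R ->
     mu [set x | (l < `|g x|)%R] <= (B * l `^ (- q))%:E) ->
  \int[mu]_(x in E) `|g x|%:E <=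
  (2 * N)%:E * mu E + (4 * expR 1 * B * N `^ (1 - q) / (q - 1))%:E.
Proof.
move=> mg mE /andP[q1 q2] N0 B0 weak.
pose b : R := expR 1.
have b0 : (0 < b)%R by exact: expR_gt0.
have b1 : (1 < b)%R by rewrite expR_gt1.
pose A k := [set x | (N * b ^+ k < `|g x|)%R].
have mA k : measurable (A k) by exact: measurable_level.
pose c k := (2 * b * (N * b ^+ k))%R.
have c0 k : (0 <= c k)%R by rewrite !mulr_ge0 ?exprn_ge0// ltW.
pose u k x : \bar R := (c k * \1_(A k) x)%:E.
have u0 k x : 0 <= u k x by rewrite lee_fin mulr_ge0.
have mu_ k : measurable_fun E (u k).
  apply: measurable_funTS; apply/measurable_EFinP.
  by apply: measurable_funM => //; exact: measurable_indic.
apply: (@le_trans _ _ (\int[mu]_(x in E) ((2 * N)%:E + \sum_(0 <= k <oo) u k x))).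
  apply: le_integral_nonmeasurable => x _; rewrite lee_fin normr_ge0/=.
  have [gN|gN] := leP `|g x|%R (2 * N)%R.
    by rewrite -[leLHS]adde0 leeD ?lee_fin// nneseries_ge0.
  (* going down from |g x| with ratio 1/e gives N e^k < |g x| < 2 N e^(k+1) *)
  have bV : (0 < b^-1 < 1)%R by rewrite invr_gt0 b0 invf_lt1.
  have hgN : (0 < 2 * N <= `|g x|)%R by rewrite mulr_gt0// ltW.
  have [k /andP[lo hi]] := geometric_level bV hgN.
  have bk (m : nat) : (0 < b ^+ m)%R by rewrite exprn_gt0.
  apply: (@le_trans _ _ (u k x)).
    rewrite /u indicE mem_set ?mulr1 /c /A/=.
      move: lo; rewrite exprVn ltr_pdivrMr// lee_fin => /ltW /le_trans; apply.
      by rewrite exprS le_eqVlt; apply/orP; left; apply/eqP; ring.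
    move: hi; rewrite exprVn ler_pdivlMr// => /(lt_le_trans _); apply.
    by rewrite ltr_pM2r// ltr_pMl// ltr1n.
  by rewrite -[leLHS]add0e leeD ?lee_fin ?mulr_ge0 ?(ltW N0)// nneseries_ge_term.
rewrite ge0_integralD//; last 3 first.
- by move=> x _; rewrite lee_fin mulr_ge0// ltW.
- by move=> x _; exact: nneseries_ge0.
- exact: ge0_emeasurable_sum.
rewrite integral_cst// leeD2l// integral_nneseries//.
pose r := expR (- (q - 1)).
apply: (@le_trans _ _ (\sum_(0 <= k <oo) ((2 * b * B * N `^ (1 - q)) * r ^+ k)%:E)).
  apply: lee_nneseries => k *; first exact: integral_ge0.
  rewrite /u; under eq_integral do rewrite EFinM.
  rewrite ge0_integralZl ?lee_fin//; last first.
    exact/measurable_funTS/measurable_EFinP/measurable_indic.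
  rewrite integral_indic//.
  have Nb0 : (0 < N * b ^+ k)%R by rewrite mulr_gt0// exprn_gt0.
  apply: (@le_trans _ _ ((c k)%:E * (B * (N * b ^+ k) `^ (- q))%:E)).
    apply: lee_wpmul2l; first by rewrite lee_fin.
    apply: le_trans (weak _ Nb0); apply: le_measure; rewrite ?inE.
    - by apply: measurableI.
    - exact: mA.
    - exact: subIsetl.
  have rk : (r ^+ k = (b ^+ k) `^ (1 - q))%R.
    by rewrite /r /b -!expRM_natl -expRM mulr1 opprB.
  have NbE : ((N * b ^+ k) * (N * b ^+ k) `^ (- q) = N `^ (1 - q) * r ^+ k)%R.
    rewrite -{1}(powRr1 (ltW Nb0)) -powRD ?(gt_eqF Nb0) ?implybT//.
    by rewrite rk powRM ?(ltW N0)// exprn_ge0// ltW.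
  rewrite -(EFinM (c k)) lee_fin le_eqVlt; apply/orP; left; apply/eqP.
  by rewrite /c -[RHS]mulrA -NbE; ring.
have r1 : (0 <= r < 1)%R by rewrite expR_ge0 expR_lt1 oppr_lt0 subr_gt0.
apply: (le_trans (nneseries_geometric_le _ r1)).
  by rewrite !mulr_ge0 ?powR_ge0// ltW.
have := @invr_1sub_expRN_le R (q - 1); rewrite subr_gt0 q1/= lerBlDr => /(_ q2) rle.
have K0 : (0 <= 2 * b * B * N `^ (1 - q))%R by rewrite !mulr_ge0 ?powR_ge0// ltW.
rewrite lee_fin (le_trans (ler_wpM2l K0 rle))// -/b le_eqVlt.
by apply/orP; left; apply/eqP; field; rewrite subr_eq0 gt_eqF.
Qed.

End integrals.

(** * The Lorentz norm through level sets *)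

Section level_sets_integral.
Context (R : realType).
Local Notation leb := (@lebesgue_measure R).
Local Open Scope ereal_scope.

Lemma integral_sqrV (c : R) : (0 < c)%R ->
  \int[leb]_(t in `]c, +oo[) (t ^- 2)%:E = (c^-1)%:E.
Proof.
move=> c0.
have pos (x : R) : (c <= x)%R -> x != 0%R by move=> /(lt_le_trans c0)/gt_eqF ->.
have ctsV (x : R) : (c <= x)%R -> {for x, continuous (fun t : R => t ^- 2)%R}.
  move=> cx; apply: continuousV; last exact: exprn_continuous.
  by rewrite expf_neq0// pos.
have der (x : R) : (c < x)%R ->
    is_derive x 1%R (fun t : R => - t^-1)%R (x ^- 2)%R.
  move=> cx; have x0 := pos x (ltW cx).
  have := is_deriveN (@is_deriveV _ (@id R) x 1%R 1%R x0 (is_derive_id x 1%R)).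
  by rewrite /GRing.scale/= mulr1 opprK.
have mV : measurable_fun `]c, +oo[ (fun t : R => t ^- 2).
  apply: open_continuous_measurable_fun; first exact: interval_open.
  by move=> x; rewrite inE/= in_itv/= andbT => /ltW; exact: ctsV.
rewrite integral_itv_obnd_cbnd; last exact/measurable_EFinP.
rewrite (@ge0_continuous_FTC2y _ _ (fun x => - x^-1)%R c 0%R).
- by rewrite EFinN oppeK add0e.
- by move=> x cx; rewrite invr_ge0 exprn_ge0// (le_trans _ cx)// ltW.
- apply/continuous_within_itvcyP; split.
    by move=> x; rewrite in_itv/= andbT => /ltW; exact: ctsV.
  by apply: cvg_at_right_filter; exact: ctsV.
- rewrite -oppr0; apply: cvgN; apply/gtr0_cvgV0; last exact: cvg_id.
  exact: nbhs_pinfty_gt.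
- by move=> x /der [].
- apply: cvg_at_right_filter; apply: cvgN; apply: cvgV; first exact: pos.
  exact: cvg_id.
- by move=> x; rewrite in_itv/= andbT => /der [_ <-]; rewrite derive1E.
Qed.

(** By Tonelli: for fixed x the integrand is t^(-2) on the half-line where
    t > a / (2 |g x|), whose integral is 2 |g x| / a. *)
Lemma integral_level_le d (T : measurableType d)
    (mu : {sigma_finite_measure set T -> \bar R}) (g : T -> R) (a : R) :
  measurable_fun [set: T] g -> (0 < a)%R ->
  let u (t : measurableTypeR R) := (t ^- 2)%:E * mu [set x | (a / (2 * t) < `|g x|)%R] in
  measurable_fun (`]0%R, +oo[%classic : set (measurableTypeR R)) u /\
  \int[leb]_(t in `]0%R, +oo[) u t <= (2 / a)%:E * \int[mu]_x `|g x|%:E.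
Proof.
move=> mg a0 u.
pose A := [set z : measurableTypeR R * T | (0 < z.1)%R /\ (a < 2 * z.1 * `|g z.2|)%R].
have mA : measurable A.
  have -> : A = [set z | (0 < z.1)%R] `&` [set z | (a < 2 * z.1 * `|g z.2|)%R] by [].
  apply: measurableI; apply: measurable_lt_set => //.
  apply: measurable_funM; first exact: measurable_funM.
  by do 2 apply: measurableT_comp => //.
(* For z.1 > 0 the power is z.1^(-2); powR is measurable on the whole line. *)
pose F (z : measurableTypeR R * T) : \bar R := (z.1 `^ (- 2) * \1_A z)%:E.
have mF : measurable_fun setT F.
  apply/measurable_EFinP/measurable_funM; last exact: measurable_indic.
  exact: (measurableT_comp (measurable_powR _) measurable_fst).
have F0 z : 0 <= F z by rewrite lee_fin mulr_ge0// powR_ge0.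
have powN2 (t : R) : (0 < t)%R -> (t `^ (- 2) = t ^- 2)%R.
  by move=> t0; rewrite powRN powR_mulrn// ltW.
have pos (t : R) : (`]0%R, +oo[%classic : set R) t -> (0 < t)%R.
  by rewrite /= in_itv/= andbT.
have FE t x : F (t, x) =
    (t `^ (- 2))%:E * (\1_[set y | (0 < t)%R /\ (a < 2 * t * `|g y|)%R] x)%:E.
  by rewrite /F EFinM.
have Fu t : (`]0%R, +oo[%classic : set R) t -> \int[mu]_y F (t, y) = u t.
  move=> /pos t0.
  have -> : (fun y => F (t, y)) = fun y =>
      (t ^- 2)%:E * (\1_[set x | (a / (2 * t) < `|g x|)%R] y)%:E.
    apply/funext => y; rewrite FE powN2//; congr (_ * (\1_ _ _)%:E).
    apply/funext => x /=; apply/propext; rewrite ltr_pdivrMr ?mulr_gt0//.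
    by rewrite mulrC t0; split => [[]|].
  rewrite ge0_integralZl//; last 2 first.
  - exact/measurable_EFinP/measurable_indic/measurable_level.
  - by rewrite lee_fin invr_ge0 sqr_ge0.
  by rewrite integral_indic ?setIT//; exact: measurable_level.
have mFu : measurable_fun setT (fun t => \int[mu]_y F (t, y)).
  exact: (measurable_fun_fubini_tonelli_F F).
split.
  apply: (eq_measurable_fun (fun t => \int[mu]_y F (t, y))).
    by move=> t /set_mem; exact: Fu.
  exact: measurable_funTS.
have -> : \int[leb]_(t in `]0%R, +oo[) u t =
    \int[leb]_(t in `]0%R, +oo[) \int[mu]_y F (t, y).
  by apply: eq_integral => t /set_mem /Fu.
apply: (@le_trans _ _ (\int[leb]_t \int[mu]_y F (t, y))).
  apply: ge0_subset_integral => //.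
  by move=> t _; exact: integral_ge0.
rewrite (fubini_tonelli F)// -ge0_integralZl//; last 2 first.
- by apply/measurable_EFinP; exact: measurableT_comp.
- by rewrite lee_fin divr_ge0// ltW.
apply: ge0_le_integral => //.
- by move=> x _; exact: integral_ge0.
- exact: (measurable_fun_fubini_tonelli_G F).
- apply: measurable_funeM; apply/measurable_EFinP; exact: measurableT_comp.
move=> x _.
have [gx0|gx0] := eqVneq (g x) 0%R.
  rewrite integral0_eq; first by rewrite mule_ge0// lee_fin divr_ge0// ltW.
  move=> t _.
  rewrite FE indicE memNset ?mule0//= gx0 normr0 mulr0 => -[_].
  by rewrite ltNge ltW.
have gx : (0 < `|g x|)%R by rewrite normr_gt0.
have c0 : (0 < a / (2 * `|g x|))%R by rewrite divr_gt0// mulr_gt0.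
rewrite le_eqVlt; apply/orP; left; apply/eqP.
transitivity (\int[leb]_(t in `](a / (2 * `|g x|))%R, +oo[) (t ^- 2)%:E).
  rewrite [RHS]integral_mkcond; apply: eq_integral => t _.
  rewrite FE patchE indicE.
  case: ifPn => [/set_mem|/negP tA]; rewrite /= ?in_itv/= ?andbT.
    move=> ct; have t0 := lt_trans c0 ct.
    rewrite mem_set ?mule1 ?powN2//; split => //.
    by move: ct; rewrite ltr_pdivrMr ?mulr_gt0// mulrCA mulrA.
  rewrite memNset ?mule0// => -[t0 at_]; apply: tA; rewrite inE/= in_itv/= andbT.
  by rewrite ltr_pdivrMr ?mulr_gt0// mulrCA mulrA.
by rewrite integral_sqrV// -EFinM; congr EFin; field; rewrite !gt_eqF.
Qed.

End level_sets_integral.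

Section rearrangement.
Context (R : realType) (n : nat).
Local Notation mu := (lebn R n).
Local Notation leb := (@lebesgue_measure R).
Implicit Types g : Rn R n -> R.
Local Open Scope ereal_scope.

Lemma rearrangement_ge0 g (t : R) : 0 <= rearrangement g t.
Proof. by apply: le_ereal_inf_tmp => _ [l [l0 _] <-]; rewrite lee_fin. Qed.

Lemma rearrangement_le g (t b : R) : (0 <= b)%R ->
  mu [set x | (b < `|g x|)%R] <= t%:E -> rearrangement g t <= b%:E.
Proof. by move=> b0 gb; apply: ereal_inf_lbound; exists b. Qed.

Lemma lt_rearrangement g (t a : R) : (0 < t)%R -> (0 <= a)%R ->
  a%:E < t%:E * rearrangement g t -> t%:E < mu [set x | (a / t < `|g x|)%R].
Proof.
move=> t0 a0; apply: contraTT; rewrite -!leNgt => at_.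
have t0' : 0 <= t%:E by rewrite lee_fin ltW.
have /(lee_wpmul2l t0') := rearrangement_le (divr_ge0 a0 (ltW t0)) at_.
by rewrite -EFinM mulrC divfK// gt_eqF.
Qed.

Lemma rearrangement_le_weak g (M t : R) : (0 < M)%R -> (0 < t)%R ->
  (forall l : R, (0 < l)%R -> mu [set x | (l < `|g x|)%R] <= (M / l)%:E) ->
  rearrangement g t <= (M / t)%:E.
Proof.
move=> M0 t0 weak; apply: rearrangement_le; first by rewrite divr_ge0 ?ltW.
apply: (le_trans (weak _ _)); first by rewrite divr_gt0.
by rewrite lee_fin invf_div mulrC divfK// gt_eqF.
Qed.

(** The infimum defining the rearrangement need not be attained at t = B / l;
    hence the bound is obtained at B / l + e for every e > 0. *)
Lemma lorentz1_pinfty_weak g (B l : R) : measurable_fun [set: Rn R n] g ->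
  (0 <= B)%R -> lorentz1 +oo g <= B%:E -> (0 < l)%R ->
  mu [set x | (l < `|g x|)%R] <= (B / l)%:E.
Proof.
move=> mg B0 gB l0; apply/lee_addgt0Pr => e e0.
pose t := (B / l + e)%R.
have t0 : (0 < t)%R by rewrite ltr_wpDl// divr_ge0// ltW.
have : t%:E * rearrangement g t <= B%:E.
  apply: le_trans gB; apply: ereal_sup_ubound; exists t => //=.
  by rewrite in_itv/= andbT.
rewrite muleC -lee_pdivlMr// -EFinM => gt.
have : rearrangement g t < l%:E.
  apply: (le_lt_trans gt); rewrite lte_fin ltr_pdivrMr// /t mulrDr mulrCA.
  by rewrite divff ?gt_eqF// mulr1 ltrDl mulr_gt0.
move=> /ereal_inf_lt [_ [l' [l'0 l't] <-]]; rewrite lte_fin => l'l.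
apply: le_trans l't; apply: le_measure; rewrite ?inE; [exact: measurable_level..|].
by move=> x /=; exact: lt_trans.
Qed.

(** The hypotheses say that g is in weak L^1 and, at each height a, is the sum
    of an L^1 function of norm at most C a^(1-s) and of a function whose weak L^1
    norm is at most a/4. If t g^*(t) > a, then |g| > a/t on a set of measure above
    t, of which the second function accounts for at most t/2; so |g1| > a/(2t) on a
    set of measure above t/2, and 1/t is at most 2 t^(-2) times that measure. The
    integral over t of the latter is at most C a^(-s) by [integral_level_le].
    Summing over the heights a = M 2^(-k) gives a geometric series of ratio
    2^(s-r). *)
Lemma lorentz1_lty g (s r M C : R) :
  (1 < s)%R -> (s < r)%R -> (0 < M)%R -> (0 <= C)%R ->
  (forall l : R, (0 < l)%R -> mu [set x | (l < `|g x|)%R] <= (M / l)%:E) ->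
  (forall a : R, (0 < a)%R -> exists g1 : Rn R n -> R,
     [/\ measurable_fun [set: Rn R n] g1,
         \int[mu]_x `|g1 x|%:E <= (C * a `^ (1 - s))%:E &
         forall l : R, (0 < l)%R -> mu [set x | (l < `|g x|)%R] <=
           mu [set x | (l / 2 < `|g1 x|)%R] + (a / (2 * l))%:E]) ->
  lorentz1 r%:E g < +oo.
Proof.
move=> s1 sr M0 C0 weak split_g.
have r0 : (0 < r)%R by rewrite (lt_trans _ sr)// (lt_trans _ s1).
have half01 : ((0 < (2^-1 : R)) && ((2^-1 : R) < 1))%R.
  by rewrite invr_gt0 invf_lt1// ltr1n ltr0n.
pose al k := (M * 2^-1 ^+ k)%R.
have al0 k : (0 < al k)%R by rewrite mulr_gt0// exprn_gt0// invr_gt0.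
have {}split_g k := split_g _ (al0 k.+1).
pose g1 k := sval (cid (split_g k)).
have mg1 k : measurable_fun setT (g1 k) by rewrite /g1; case: cid => ? [].
have ig1 k : \int[mu]_x `|g1 k x|%:E <= (C * al k.+1 `^ (1 - s))%:E.
  by rewrite /g1; case: cid => ? [].
have lg1 k (l : R) : (0 < l)%R -> mu [set x | (l < `|g x|)%R] <=
    mu [set x | (l / 2 < `|g1 k x|)%R] + (al k.+1 / (2 * l))%:E.
  by rewrite /g1; case: cid => ? []//= _ _ /[apply].
clearbody g1.
pose v k (t : measurableTypeR R) :=
  (t ^- 2)%:E * mu [set x | (al k.+1 / (2 * t) < `|g1 k x|)%R].
have mv k : measurable_fun (`]0%R, +oo[%classic : set (measurableTypeR R)) (v k).
  by have [] := integral_level_le mu (mg1 k) (al0 k.+1).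
have iv k : \int[leb]_(t in `]0%R, +oo[) v k t <=
    (2 / al k.+1)%:E * \int[mu]_x `|g1 k x|%:E.
  by have [] := integral_level_le mu (mg1 k) (al0 k.+1).
have v0 k t : 0 <= v k t by rewrite mule_ge0// lee_fin invr_ge0 sqr_ge0.
have vlevel k (t : R) : (0 < t)%R -> (al k.+1)%:E < t%:E * rearrangement g t ->
    (t ^- 1)%:E <= 2%:E * v k t.
  move=> t0 /(lt_rearrangement t0 (ltW (al0 _))) lev.
  have at0 : (0 < al k.+1 / t)%R by rewrite divr_gt0.
  move: (lt_le_trans lev (lg1 k _ at0)).
  have -> : (al k.+1 / (2 * (al k.+1 / t)) = t / 2)%R.
    by field; rewrite !gt_eqF.
  have -> : (al k.+1 / t / 2 = al k.+1 / (2 * t))%R by field; rewrite !gt_eqF.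
  rewrite -lteBlDr// -EFinB => /ltW lev'.
  rewrite /v muleA -EFinM.
  apply: (@le_trans _ _ ((2 * t ^- 2)%:E * (t - t / 2)%:E)).
    by rewrite -EFinM lee_fin le_eqVlt; apply/orP; left; apply/eqP; field;
      rewrite gt_eqF.
  by apply: lee_wpmul2l => //; rewrite lee_fin mulr_ge0// invr_ge0 sqr_ge0.
apply: poweR_lty.
apply: (@le_lt_trans _ _ (\int[leb]_(t in `]0%R, +oo[)
    \sum_(0 <= k <oo) ((al k) `^ r * 2)%:E * v k t)).
  apply: le_integral_nonmeasurable => t /=; rewrite in_itv/= andbT => t0.
  apply/andP; split; first by rewrite mule_ge0 ?poweR_ge0 ?lee_fin ?invr_ge0 ?ltW.
  have u0 k : 0 <= (al k `^ r * 2)%:E * v k t.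
    by rewrite mule_ge0// lee_fin mulr_ge0// powR_ge0.
  have := rearrangement_le_weak M0 t0 weak.
  case: (rearrangement g t) (rearrangement_ge0 g t) (fun k => vlevel k t t0) => [h|_ _|//]; last first.
    by rewrite leye_eq.
  rewrite !lee_fin => h0 lev hM; rewrite -EFinM.
  have [->|th0] := eqVneq (t * h)%R 0%R.
    by rewrite powR0 ?gt_eqF// mul0r; exact: nneseries_ge0.
  have : (0 < t * h <= M)%R.
    by rewrite lt_neqAle eq_sym th0 mulr_ge0 ?(ltW t0)// mulrC -ler_pdivlMr.
  move=> /(geometric_level half01) [k /andP[lo hi]].
  apply: le_trans (nneseries_ge_term k u0).
  rewrite !EFinM -muleA; apply: lee_pmul.
  - by rewrite lee_fin powR_ge0.
  - by rewrite lee_fin invr_ge0 ltW.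
  - rewrite lee_fin; apply: ge0_ler_powR => //; rewrite ?nnegrE ?(ltW r0)//.
      by rewrite mulr_ge0 ?(ltW t0).
    exact: ltW (al0 k).
  - by apply: lev; rewrite -EFinM lte_fin.
rewrite integral_nneseries//; last 2 first.
- by move=> k; apply: measurable_funeM.
- by move=> k t _; rewrite mule_ge0// lee_fin mulr_ge0// powR_ge0.
pose q := (2^-1 `^ (r - s))%R.
pose c := (8 * C * 2^-1 `^ (1 - s) * M `^ (r - s))%R.
apply: (@le_lt_trans _ _ (\sum_(0 <= k <oo) (c * q ^+ k)%:E)).
  apply: lee_nneseries => k *.
    by apply: integral_ge0 => t _; rewrite mule_ge0// lee_fin mulr_ge0// powR_ge0.
  rewrite ge0_integralZl ?lee_fin ?mulr_ge0 ?powR_ge0//.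
  have E0 : 0 <= (al k `^ r * 2)%:E by rewrite lee_fin mulr_ge0// powR_ge0.
  apply: (le_trans (lee_wpmul2l E0 (iv k))).
  have E1 : 0 <= (2 / al k.+1)%:E by rewrite lee_fin divr_ge0// ltW.
  apply: (le_trans (lee_wpmul2l E0 (lee_wpmul2l E1 (ig1 k)))).
  rewrite -!EFinM lee_fin.
  have alS : al k.+1 = (2^-1 * al k)%R by rewrite /al exprS mulrCA.
  have al_split : (al k `^ (1 - s) * al k `^ r = al k * (M `^ (r - s) * q ^+ k))%R.
    have -> : (M `^ (r - s) * q ^+ k = al k `^ (r - s))%R.
      rewrite -powR_mulrn ?powR_ge0// /q powRAC -powRM ?powR_ge0 ?(ltW M0)//.
      by rewrite powR_mulrn ?invr_ge0.
    rewrite -powRD ?(gt_eqF (al0 k)) ?implybT//.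
    by rewrite -{2}(powRr1 (ltW (al0 k))) -powRD ?(gt_eqF (al0 k)) ?implybT//;
      congr powR; ring.
  rewrite alS (@powRM _ 2^-1 (al k)) ?invr_ge0 ?(ltW (al0 _))// /c.
  rewrite [leLHS](_ : _ = 8 * C * 2^-1 `^ (1 - s) *
      (al k `^ (1 - s) * al k `^ r) / al k)%R; last first.
    by field; rewrite gt_eqF.
  by rewrite al_split le_eqVlt; apply/orP; left; apply/eqP; field; rewrite gt_eqF.
apply: (le_lt_trans (nneseries_geometric_le _ _)); last exact: ltry.
- by rewrite !mulr_ge0// powR_ge0.
- rewrite powR_ge0/=; have <- : (1 `^ (r - s) = 1 :> R)%R by rewrite powR1.
  by apply: gt0_ltr_powR; rewrite ?subr_gt0 ?nnegrE ?invr_ge0// invf_lt1// ltr1n.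
Qed.

End rearrangement.

(** * Weak-type bounds for Calderon-Zygmund operators *)

Section weak_type.
Context (R : realType) (n : nat).
Local Notation mu := (lebn R n).
Context (T : (Rn R n -> R) -> Rn R n -> R) (hT : CZ_operator T).
Implicit Types f g h : Rn R n -> R.
Local Open Scope ereal_scope.

Lemma CZ_measurable f : f \in Lfun mu 1 -> measurable_fun [set: Rn R n] (T f).
Proof. by case: hT => _ _ _ _ [C bC] /bC []. Qed.

Lemma CZ_linear (k : R) f g h : f \in Lfun mu 1 -> g \in Lfun mu 1 ->
  h = (fun x => k * f x + g x)%R -> T h = (fun x => k * T f x + T g x)%R %[ae mu].
Proof. by move=> fL gL ->; case: hT => _ _ _ lin _; exact: lin. Qed.

Lemma CZ0 : \int[mu]_x `|T (fun=> 0%R) x|%:E = 0.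
Proof.
have L0 := Lfun1_cst0 mu.
have := CZ_linear (k := 1%R) (h := fun=> 0%R) L0 L0.
rewrite (_ : (fun=> 1 * 0 + 0) = fun=> 0)%R => [/(_ erefl) T0|]; last first.
  by apply/funext => x; rewrite mulr0 addr0.
rewrite -(integral0 mu setT); apply: ge0_ae_eq_integral => //.
  apply/measurable_EFinP; apply: measurableT_comp => //; exact: CZ_measurable.
apply: filterS T0 => x /= + xT => /(_ xT) T0x.
by move: T0x; rewrite mul1r -[LHS]addr0 => /addrI <-; rewrite normr0.
Qed.

Lemma CZ_weak11 : exists2 C : R, (0 < C)%R & forall f, f \in Lfun mu 1 ->
  forall l : R, (0 < l)%R ->
  mu [set x | (l < `|T f x|)%R] <= (C / l)%:E * \int[mu]_x `|f x|%:E.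
Proof.
case: hT => _ _ _ _ [C bC]; exists (Num.max C 1%R) => [|f fL l l0].
  by rewrite lt_max ltr01 orbT.
have [mTf] := bC _ fL; rewrite Lnorm1 /= => TfC.
have fin : \int[mu]_x `|f x|%:E \is a fin_num.
  rewrite ge0_fin_numE ?integral_ge0//.
  by case/Lfun1_integrable/integrableP : fL.
rewrite -(fineK fin) -EFinM mulrAC.
apply: lorentz1_pinfty_weak => //.
  by rewrite mulr_ge0 ?fine_ge0 ?integral_ge0// le_max ler01 orbT.
apply: (le_trans TfC); rewrite EFinM fineK//.
by rewrite lee_wpmul2r ?integral_ge0// lee_fin le_max lexx.
Qed.

Lemma CZ_weak22 : exists2 C : R, (0 < C)%R & forall f, f \in Lfun mu 2%:E ->
  forall l : R, (0 < l)%R ->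
  mu [set x | (l < `|T f x|)%R] <= (C / l ^+ 2)%:E * \int[mu]_x (`|f x| `^ 2)%:E.
Proof.
case: hT => _ [C bC] _ _ _; pose C' := Num.max C 1%R.
have C'0 : (0 < C')%R by rewrite lt_max ltr01 orbT.
exists (C' `^ 2)%R => [|f fL l l0]; first exact: powR_gt0.
have [mTf TfC] := bC _ fL.
pose h x := (`|T f x| `^ 2)%R.
have hE x : (`|h x| = `|T f x| `^ 2)%R by rewrite ger0_norm ?powR_ge0.
have -> : [set x | (l < `|T f x|)%R] = [set x | (l ^+ 2 < `|h x|)%R].
  apply/seteqP; split => x /=; rewrite hE powR_mulrn//;
  by rewrite ltr_pXn2r// nnegrE ltW.
have l20 : (0 < l ^+ 2)%R by rewrite exprn_gt0.
have mh : measurable_fun setT h.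
  apply: (measurableT_comp (measurable_powR _)); exact: measurableT_comp.
rewrite mulrC EFinM -muleA lee_pdivlMl//.
apply: (le_trans (level_le_integral mu mh l20)).
have -> : \int[mu]_x `|h x|%:E = 'N[mu]_2%:E[EFin \o T f] `^ 2.
  by rewrite poweR_Lnorm//; apply: eq_integral => x _ /=; rewrite hE.
have -> : \int[mu]_x (`|f x| `^ 2)%:E = 'N[mu]_2%:E[EFin \o f] `^ 2.
  by rewrite poweR_Lnorm//.
rewrite -poweR_EFin -poweRM ?Lnorm_ge0 ?lee_fin ?(ltW C'0)//.
apply: gt0_ler_poweR => //.
- by rewrite in_itv/= leey Lnorm_ge0.
- by rewrite in_itv/= leey mule_ge0 ?Lnorm_ge0// lee_fin ltW.
- apply: (le_trans TfC); rewrite lee_wpmul2r ?Lnorm_ge0//.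
  by rewrite lee_fin le_max lexx.
Qed.

(** Split f at the height l itself: the weak type (1,1) bound for the large
    part and the L^2 bound for the small part both reduce to the integral of
    |f|^q at the single level l. As no integration over levels takes place, the
    constant does not depend on q. *)
Lemma CZ_weakqq : exists2 C : R, (0 < C)%R & forall f, f \in Lfun mu 1 ->
  forall q l : R, (1 < q <= 2)%R -> (0 < l)%R ->
  mu [set x | (l < `|T f x|)%R] <=
  (C * l `^ (- q))%:E * \int[mu]_x (`|f x| `^ q)%:E.
Proof.
have [C1 C10 weak1] := CZ_weak11; have [C2 C20 weak2] := CZ_weak22.
exists (2 * C1 + 4 * C2)%R => [|f fL q l /andP[q1 q2] l0].
  by rewrite addr_gt0// mulr_gt0.
have mf := Lfun1_mfun fL.
pose hi x := (if l < `|f x| then f x else 0)%R.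
pose lo x := (if l < `|f x| then 0 else f x)%R.
have mb : measurable_fun setT (fun x => (l < `|f x|)%R).
  apply: measurable_fun_ltr => //; exact: measurableT_comp.
have mhi : measurable_fun setT hi by apply: measurable_fun_ifT.
have mlo : measurable_fun setT lo by apply: measurable_fun_ifT.
have mnf : measurable_fun setT (fun x => `|f x|)%R by exact: measurableT_comp.
have hiL : hi \in Lfun mu 1.
  apply: Lfun1P => //; apply: le_lt_trans (Lfun1_lty fL).
  apply: le_integral_nonmeasurable => x _; rewrite !lee_fin normr_ge0/= /hi.
  by case: ifP => // _; rewrite normr0.
have loL : lo \in Lfun mu 1.
  apply: Lfun1P => //; apply: le_lt_trans (Lfun1_lty fL).
  apply: le_integral_nonmeasurable => x _; rewrite !lee_fin normr_ge0/= /lo.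
  by case: ifP => // _; rewrite normr0.
have loL2 : lo \in Lfun mu 2%:E.
  apply: Lfun2P => //.
  apply: (@le_lt_trans _ _ (l%:E * \int[mu]_x `|f x|%:E)).
    apply: integral_le_scale => //; first exact: ltW.
    move=> x _; rewrite powR_ge0/= powR_mulrn// /lo.
    case: ltP => lf; first by rewrite normr0 expr0n/= mulr_ge0// ltW.
    by rewrite expr2 ler_wpM2r.
  by rewrite lte_mul_pinfty ?lee_fin ?(ltW l0)// Lfun1_lty.
have fE : f = (fun x => 1 * hi x + lo x)%R.
  by apply/funext => x; rewrite mul1r /hi /lo; case: ifP => _; rewrite ?addr0 ?add0r.
have TfE : T f = (fun x => T hi x + T lo x)%R %[ae mu].
  have := CZ_linear hiL loL fE.
  by apply: filterS => x /= + xT => /(_ xT) ->; rewrite mul1r.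
have l20 : (0 < l / 2)%R by rewrite divr_gt0.
apply: (le_trans (level_add l _ _ _ TfE)); [exact: CZ_measurable..|].
have mq : measurable_fun setT (fun x => `|f x| `^ q)%R by exact: measurable_normr_powR.
have Ihi : \int[mu]_x `|hi x|%:E <= (l `^ (1 - q))%:E * \int[mu]_x (`|f x| `^ q)%:E.
  apply: integral_le_scale => //; first exact: powR_ge0.
  move=> x _; rewrite normr_ge0/= /hi; case: ltP => lf; last first.
    by rewrite normr0 mulr_ge0// powR_ge0.
  have f0 := lt_trans l0 lf.
  rewrite -[leLHS]powRr1// -{1}[1%R](subrK q) powRD ?(gt_eqF f0) ?implybT//.
  rewrite ler_wpM2r ?powR_ge0// -opprB !powRN lef_pV2 ?posrE ?powR_gt0//.
  by apply: ge0_ler_powR; rewrite ?nnegrE ?subr_ge0 ?ltW.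
have Ilo : \int[mu]_x (`|lo x| `^ 2)%:E <= (l `^ (2 - q))%:E * \int[mu]_x (`|f x| `^ q)%:E.
  apply: integral_le_scale => //; first exact: powR_ge0.
  move=> x _; rewrite powR_ge0/= /lo; case: ltP => lf.
    by rewrite normr0 powR0 ?mulr_ge0 ?powR_ge0.
  have [->|f0] := eqVneq (f x) 0%R.
    by rewrite normr0 powR0 ?mulr_ge0 ?powR_ge0.
  rewrite -{1}[2%R](subrK q) powRD ?normr_eq0 ?(negbTE f0) ?implybT//.
  rewrite ler_wpM2r ?powR_ge0//.
  by apply: ge0_ler_powR; rewrite ?nnegrE ?subr_ge0 ?(ltW l0).
rewrite mulrDl EFinD ge0_muleDl ?lee_fin ?mulr_ge0 ?powR_ge0 ?(ltW C10) ?(ltW C20)//.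
have E1 : 0 <= (C1 / (l / 2))%:E by rewrite lee_fin divr_ge0// ltW.
have E2 : 0 <= (C2 / (l / 2) ^+ 2)%:E by rewrite lee_fin divr_ge0 ?exprn_ge0// ltW.
apply: leeD.
  apply: (le_trans (weak1 _ hiL _ l20)).
  apply: (le_trans (lee_wpmul2l E1 Ihi)).
  rewrite muleA -EFinM lee_wpmul2r ?integral_ge0//.
  rewrite lee_fin le_eqVlt; apply/orP; left; apply/eqP.
  rewrite powRD ?(gt_eqF l0) ?implybT// powRr1 ?(ltW l0)//.
  by field; rewrite gt_eqF.
apply: (le_trans (weak2 _ loL2 _ l20)).
apply: (le_trans (lee_wpmul2l E2 Ilo)).
rewrite muleA -EFinM lee_wpmul2r ?integral_ge0//.
rewrite lee_fin le_eqVlt; apply/orP; left; apply/eqP.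
rewrite powRD ?(gt_eqF l0) ?implybT// powR_mulrn ?(ltW l0)//.
by field; rewrite gt_eqF.
Qed.

End weak_type.

(** * Cubes *)

Section cubes.
Context (R : realType) (n : nat).
Local Notation mu := (lebn R n).
Implicit Types (x y c : Rn R n) (f : Rn R n -> R) (l : R).

Lemma ler_eucl_dist x y i : `|tnth x i - tnth y i| <= eucl_dist x y.
Proof.
rewrite -sqrtr_sqr; apply: ler_wsqrtr; rewrite (bigD1 i)//= lerDl.
by apply: sumr_ge0 => j _; exact: sqr_ge0.
Qed.

Lemma eucl_dist_le x y (m : R) : 0 <= m ->
  (forall i, `|tnth x i - tnth y i| <= m) -> eucl_dist x y <= n%:R * m.
Proof.
move=> m0 xym; rewrite -[leRHS]ger0_norm ?mulr_ge0// -sqrtr_sqr.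
apply: ler_wsqrtr; apply: (@le_trans _ _ (\sum_(i < n) m ^+ 2)).
  by apply: ler_sum => i _; rewrite -real_normK ?num_real// lerXn2r ?nnegrE.
rewrite sumr_const card_ord exprMn -[m ^+ 2 *+ n]mulr_natl ler_wpM2r ?sqr_ge0//.
have nn (k : nat) : (k <= k ^ 2)%N by case: k => // k; rewrite -mulnn leq_pmulr.
by rewrite -natrX ler_nat nn.
Qed.

Lemma eucl_distxx x : eucl_dist x x = 0.
Proof.
by rewrite /eucl_dist big1 ?sqrtr0// => i _; rewrite subrr expr0n.
Qed.

Definition cube_side c l (i : 'I_n) : set (measurableTypeR R) :=
  `[tnth c i, tnth c i + l]%classic.

Lemma cubeE c l : cube c l = [set x | forall i, cube_side c l i (tnth x i)].
Proof.
by apply/seteqP; split => x /= xQ i; have := xQ i; rewrite /cube_side /= in_itv.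
Qed.

Lemma measurable_cube_side c l i : measurable (cube_side c l i).
Proof. exact: measurable_itv. Qed.

Lemma measurable_cube c l : measurable (cube c l).
Proof. by rewrite cubeE; apply: measurable_box; exact: measurable_cube_side. Qed.

Lemma lebn_cube c l : 0 <= l -> mu (cube c l) = (l ^+ n)%:E.
Proof.
move=> l0; rewrite cubeE lebn_box; last exact: measurable_cube_side.
rewrite (eq_bigr (fun=> l%:E)) => [|i _]; last first.
  rewrite /cube_side lebesgue_measure_itv/= lte_fin ltrDl; case: ltP => l0'.
    by rewrite -EFinB addrAC subrr add0r.
  by congr EFin; apply/eqP; rewrite eq_le l0 l0'.
by rewrite prodEFin prodr_const card_ord.
Qed.

Lemma supp_neq0 f x : f x != 0 -> supp f x.
Proof. by move=> fx e e0; exists x => //; rewrite eucl_distxx. Qed.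

Lemma supp_cube f c l e x i : 0 < e -> (forall y, ~ cube c l y -> f y = 0) ->
  supp f x -> tnth c i - e <= tnth x i <= tnth c i + l + e.
Proof.
move=> e0 f0 /(_ _ e0) [y xy fy].
have /(_ i)/andP[cy yc] : cube c l y by apply: contrapT => /f0/eqP; exact/negP.
have := le_lt_trans (ler_eucl_dist x y i) xy; rewrite ltr_norml => /andP[lo hi].
by apply/andP; split; lra.
Qed.

Lemma compactly_supported_cube f c l : 0 < l ->
  (forall y, ~ cube c l y -> f y = 0) -> compactly_supported f.
Proof.
move=> l0 f0; exists (n%:R * (3 * l)) => x y xf yf; apply: eucl_dist_le => [|i].
  by rewrite mulr_ge0// ltW.
have /andP[] := supp_cube i l0 f0 xf; have /andP[] := supp_cube i l0 f0 yf.
by move=> *; rewrite ler_norml; apply/andP; split; lra.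
Qed.

(** A cube centred at the corner c of cube c l. Its half-side 2 n l is at least
    twice the distance from c to any point of cube c l, as the Hormander condition
    with base point c requires. *)
Definition dilate c l : set (Rn R n) :=
  cube [tuple tnth c i - 2 * n%:R * l | i < n] (4 * n%:R * l).

Lemma not_dilate c l x : ~ dilate c l x ->
  exists i, 2 * n%:R * l < `|tnth x i - tnth c i|.
Proof.
move=> /existsNP[i /negP]; rewrite tnth_mktuple => xi; exists i.
by rewrite ltNge ler_norml; apply: contra xi => /andP[? ?]; apply/andP; split; lra.
Qed.

Local Open Scope ereal_scope.

Lemma integral_indic_cube c l : (0 <= l)%R ->
  \int[mu]_x (\1_(cube c l) x)%:E = (l ^+ n)%:E.
Proof.
move=> l0; rewrite integral_indic//; last exact: measurable_cube.
by rewrite setIT; exact: lebn_cube.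
Qed.

Lemma integral_bounded_cube f c l (M r : R) : (0 <= l)%R -> (0 < r)%R ->
  (forall x, `|f x| <= M)%R -> (forall x, ~ cube c l x -> f x = 0%R) ->
  \int[mu]_x (`|f x| `^ r)%:E < +oo.
Proof.
move=> l0 r0 fM f0.
apply: (@le_lt_trans _ _ ((M `^ r)%:E * \int[mu]_x (\1_(cube c l) x)%:E)).
  apply: integral_le_scale => //.
  - exact: (measurable_indic (measurable_cube c l)).
  - exact: powR_ge0.
  move=> x _; rewrite powR_ge0/= indicE; have [xQ|xQ] := pselect (cube c l x).
    rewrite mem_set// mulr1; apply: ge0_ler_powR => //; rewrite ?nnegrE ?(ltW r0)//.
    exact: le_trans (fM x).
  by rewrite f0// normr0 powR0 ?gt_eqF// memNset// mulr0.
by rewrite integral_indic_cube// -EFinM ltry.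
Qed.

Lemma bounded_cube_Lfun1 f c l (M : R) : (0 <= l)%R -> measurable_fun setT f ->
  (forall x, `|f x| <= M)%R -> (forall x, ~ cube c l x -> f x = 0%R) ->
  f \in Lfun mu 1.
Proof.
move=> l0 mf fM f0; apply: Lfun1P => //.
suff <- : \int[mu]_x (`|f x| `^ 1)%:E = \int[mu]_x `|f x|%:E.
  exact: (integral_bounded_cube l0 ltr01 fM f0).
by apply: eq_integral => x _; rewrite powRr1.
Qed.

Lemma ler_add_powR (N q y : R) : (0 < N)%R -> (1 < q)%R -> (0 <= y)%R ->
  (y <= N + N `^ (1 - q) * y `^ q)%R.
Proof.
move=> N0 q1 y0; have [yN|Ny] := leP y N.
  by rewrite (le_trans yN)// lerDl mulr_ge0// powR_ge0.
have {}y0 := lt_trans N0 Ny.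
rewrite ler_wpDl// ?(ltW N0)// -{1}(powRr1 (ltW y0)) -{1}[1%R](subrK q).
rewrite powRD ?(gt_eqF y0) ?implybT// ler_wpM2r ?powR_ge0//.
rewrite -opprB !powRN lef_pV2 ?posrE ?powR_gt0//.
by apply: ge0_ler_powR; rewrite ?nnegrE ?subr_ge0 ?ltW.
Qed.

(** The integrated form of [ler_add_powR], a linear substitute for the Holder
    inequality. *)
Lemma integral_cube_le_powR f c l (N q : R) : (0 <= l)%R -> (0 < N)%R -> (1 < q)%R ->
  measurable_fun setT f -> (forall x, ~ cube c l x -> f x = 0%R) ->
  \int[mu]_x `|f x|%:E <=
  (N * l ^+ n)%:E + (N `^ (1 - q))%:E * \int[mu]_x (`|f x| `^ q)%:E.
Proof.
move=> l0 N0 q1 mf f0.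
have m1 := measurable_indic (measurable_cube c l).
have mq := measurable_normr_powR q mf.
rewrite EFinM -(integral_indic_cube c l0) -!ge0_integralZl//; last 4 first.
- exact/measurable_EFinP.
- by rewrite lee_fin powR_ge0.
- exact/measurable_EFinP.
- by rewrite lee_fin ltW.
rewrite -ge0_integralD//; last 4 first.
- by move=> x _; rewrite mule_ge0// lee_fin ltW.
- exact/measurable_funeM/measurable_EFinP.
- by move=> x _; rewrite mule_ge0// lee_fin powR_ge0.
- exact/measurable_funeM/measurable_EFinP.
apply: le_integral_nonmeasurable => x _; rewrite lee_fin normr_ge0/=.
rewrite -!EFinM -EFinD lee_fin indicE; have [xQ|xQ] := pselect (cube c l x).
  by rewrite mem_set// mulr1 ler_add_powR.
by rewrite f0// normr0 memNset// mulr0 add0r mulr_ge0// powR_ge0.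
Qed.

Lemma integral_le_normalized f c l (q N : R) : (0 < l)%R -> (0 < N)%R ->
  (1 < q)%R -> measurable_fun setT f -> (forall x, ~ cube c l x -> f x = 0%R) ->
  \int[mu]_x (`|f x| `^ q)%:E <= (N `^ q * l ^+ n)%:E ->
  \int[mu]_x `|f x|%:E <= (2 * (N * l ^+ n))%:E.
Proof.
move=> l0 N0 q1 mf f0 fq.
have NN : (N `^ (1 - q) * N `^ q = N)%R.
  by rewrite -powRD ?subrK ?powRr1 ?(ltW N0)// (gt_eqF N0) implybT.
apply: (le_trans (integral_cube_le_powR (ltW l0) N0 q1 mf f0)).
have p0 : 0 <= (N `^ (1 - q))%:E by rewrite lee_fin powR_ge0.
apply: (le_trans (leeD2l _ (lee_wpmul2l p0 fq))).
rewrite -EFinM -EFinD lee_fin [X in (_ + X)%R](_ : _ = N * l ^+ n)%R; first lra.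
by rewrite mulrA NN.
Qed.

End cubes.

(** * Molecules *)

Section molecules.
Context (R : realType) (n : nat) (hn : (0 < n)%N).
Local Notation mu := (lebn R n).
Context (T : (Rn R n -> R) -> Rn R n -> R) (hT : CZ_operator T).
Local Open Scope ereal_scope.

(** As f has mean zero, K x y may be replaced by K x y - K x c in the integral
    that represents T f x; Tonelli and the Hormander condition then conclude. The
    size bound on K makes K x * f integrable. *)
Lemma CZ_far : exists2 A : R, (0 < A)%R & forall (f : Rn R n -> R) c l, (0 < l)%R ->
  f \in Lfun mu 1 -> f \in Lfun mu 2%:E ->
  (forall y, ~ cube c l y -> f y = 0%R) -> (\int[mu]_y f y = 0)%R ->
  \int[mu]_(x in ~` dilate c l) `|T f x|%:E <= A%:E * \int[mu]_y `|f y|%:E.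
Proof.
case: hT => _ _ [K [mK [A [sizeK smoothK]]] repK] _ _.
exists (Num.max A 1%R) => [|f c l l0 f1 f2 f0 If].
  by rewrite lt_max ltr01 orbT.
have n1 : (1 <= n%:R :> R)%R by rewrite ler1n.
have nl : (l <= n%:R * l)%R by rewrite ler_peMl// ltW.
have mf := Lfun1_mfun f1.
have mD : measurable (~` dilate c l) by apply: measurableC; exact: measurable_cube.
have mKx x : measurable_fun setT (K x).
  exact: (measurableT_comp mK (pair1_measurable x)).
have mKc : measurable_fun setT (fun z : Rn R n * Rn R n => K z.1 c).
  have mc : measurable_fun setT (fun z : Rn R n * Rn R n => (z.1, c)).
    by apply: measurable_fun_pair => //; exact: measurable_cst.
  exact: (measurableT_comp mK mc).
pose F (z : Rn R n * Rn R n) : \bar R :=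
  (\1_(~` dilate c l) z.1 * (`|K z.1 z.2 - K z.1 c| * `|f z.2|))%:E.
have mF : measurable_fun setT F.
  apply/measurable_EFinP/measurable_funM.
    exact: (measurableT_comp (measurable_indic mD) measurable_fst).
  apply: measurable_funM.
    by apply: measurableT_comp => //; exact: measurable_funB.
  by do 2 apply: measurableT_comp => //.
have F0 z : 0 <= F z by rewrite lee_fin !mulr_ge0.
have intf : mu.-integrable setT (EFin \o f) by exact/Lfun1_integrable.
have far x : ~ dilate c l x -> (forall y, cube c l y -> l <= eucl_dist x y)%R /\
    ~ supp f x.
  move=> /not_dilate [i xi]; split.
    move=> y /(_ i)/andP[cy yc]; apply: le_trans (ler_eucl_dist x y i).
    have : (`|tnth y i - tnth c i| <= l)%R by rewrite ler_norml; apply/andP; lra.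
    have := ler_distD (tnth y i) (tnth x i) (tnth c i); lra.
  move=> /(supp_cube i (divr_gt0 l0 (ltr0n _ 2)) f0) /andP[lo hi].
  move: xi; rewrite ltNge => /negP; apply; rewrite ler_norml; apply/andP; lra.
have intKf x : ~ dilate c l x -> mu.-integrable setT (fun y => (K x y * f y)%:E).
  move=> /far [xl _].
  apply: (le_integrable _ _ _ (integrableZl _ (`|A| / l ^+ n)%R intf)) => //.
    by apply/measurable_EFinP; exact: measurable_funM.
  move=> y _ /=; rewrite lee_fin normrM normrM.
  have [->|fy] := eqVneq (f y) 0%R; first by rewrite normr0 !mulr0.
  have Qy : cube c l y by apply: contrapT => /f0/eqP; exact/negP.
  have ly := xl _ Qy; rewrite ler_wpM2r//.
  have xy : x <> y by move=> xy; move: ly; rewrite xy eucl_distxx leNgt l0.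
  have d0 := lt_le_trans l0 ly.
  apply: (le_trans (sizeK _ _ xy)); apply: le_trans (ler_norm _).
  apply: (@le_trans _ _ (`|A| / eucl_dist x y ^+ n)%R).
    by rewrite ler_wpM2r ?ler_norm// invr_ge0 exprn_ge0// ltW.
  rewrite ler_wpM2l// lef_pV2 ?posrE ?exprn_gt0//.
  by rewrite lerXn2r ?nnegrE// ltW.
have Tf_le : \int[mu]_(x in ~` dilate c l) `|T f x|%:E <= \int[mu]_x \int[mu]_y F (x, y).
  apply: (@le_trans _ _ (\int[mu]_(x in ~` dilate c l) \int[mu]_y F (x, y))); last first.
    apply: ge0_subset_integral => //.
    - exact: (measurable_fun_fubini_tonelli_F F).
    - by move=> x _; exact: integral_ge0.
  apply: ae_ge0_le_integral => //.
  - apply/measurable_EFinP/measurableT_comp => //; apply: measurable_funTS.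
    exact: CZ_measurable.
  - by move=> x _; exact: integral_ge0.
  - apply: measurable_funTS; exact: (measurable_fun_fubini_tonelli_F F).
  have := repK _ f2 (compactly_supported_cube l0 f0).
  apply: filterS => x Tfx nDx; have [_ /Tfx ->] := far _ nDx.
  have -> : (\int[mu]_y (K x y * f y) = \int[mu]_y ((K x y - K x c) * f y))%R.
    have -> : (\int[mu]_y ((K x y - K x c) * f y) =
        \int[mu]_y (K x y * f y - K x c * f y))%R.
      by apply: eq_Rintegral => y _; rewrite mulrBl.
    rewrite RintegralB//; last 2 first.
    - exact: intKf.
    - exact: (integrableZl _ (K x c) intf).
    by rewrite RintegralZl// If mulr0 subr0.
  have intD : mu.-integrable setT (EFin \o (fun y => (K x y - K x c) * f y)%R).
    rewrite (_ : _ \o _ = fun y => (K x y * f y)%:E - (K x c * f y)%:E).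
      exact: integrableB (intKf _ nDx) (integrableZl _ (K x c) intf).
    by apply/funext => y; rewrite /= mulrBl.
  rewrite EFin_normr_Rintegral//; apply: (le_trans (le_abse_integral _ _ _)) => //.
    by case/integrableP : intD.
  apply: le_integral_nonmeasurable => y _; rewrite lee_fin normr_ge0/=.
  by rewrite lee_fin indicE mem_set// mul1r normrM.
apply: (le_trans Tf_le); rewrite (fubini_tonelli F)//.
rewrite -ge0_integralZl//; last 2 first.
- by apply/measurable_EFinP; exact: measurableT_comp.
- by rewrite lee_fin le_max ler01 orbT.
apply: le_integral_nonmeasurable => y _; rewrite integral_ge0//=.
have [fy0|fy0] := eqVneq (f y) 0%R.
  rewrite integral0_eq => [|x _]; first by rewrite fy0 normr0 mule0.
  by rewrite /F/= fy0 normr0 !mulr0.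
have Qy : cube c l y by apply: contrapT => /f0/eqP; exact/negP.
have cyl : (2 * eucl_dist c y <= 2 * n%:R * l)%R.
  rewrite -mulrA ler_wpM2l//; apply: eucl_dist_le => [|i]; first exact: ltW.
  by have /andP[? ?] := Qy i; rewrite ler_norml; apply/andP; lra.
pose G x := (\1_(~` dilate c l) x * `|K x y - K x c|)%R.
have mG : measurable_fun setT G.
  apply: measurable_funM; first exact: measurable_indic.
  apply: measurableT_comp => //; apply: measurable_funB.
    exact: (measurableT_comp mK (pair2_measurable y)).
  exact: (measurableT_comp mK (pair2_measurable c)).
have -> : (fun x => F (x, y)) = fun x => (`|f y|)%:E * (G x)%:E.
  by apply/funext => x; rewrite /F/= mulrA mulrC EFinM.
rewrite ge0_integralZl_EFin//; last 2 first.
- by move=> x _; rewrite lee_fin mulr_ge0.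
- exact/measurable_EFinP.
rewrite muleC lee_wpmul2r ?lee_fin//.
apply: (@le_trans _ _ A%:E); last by rewrite lee_fin le_max lexx.
apply: le_trans (smoothK c y).
rewrite [leRHS]integral_mkcond.
apply: le_integral_nonmeasurable => x _.
rewrite lee_fin mulr_ge0//= patchE /G indicE.
have [xD|xD] := pselect (dilate c l x).
  have nDx : ~ (~` dilate c l) x by [].
  by rewrite memNset// mul0r; case: ifP => // _; rewrite lee_fin.
rewrite mem_set// mul1r mem_set ?lee_fin 1?distrC//=.
have [i xi] := not_dilate xD.
exact: (le_trans cyl (ltW (lt_le_trans xi (ler_eucl_dist x c i)))).
Qed.

(** The factor 1/(q - 1) comes from the dilated cube. The boundedness of f gives
    access to the kernel, and the bound M does not enter C. The factor 20 is the
    loss in [truncation]. *)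
Lemma CZ_molecule : exists2 C : R, (0 < C)%R &
  forall (f : Rn R n -> R) c (l q N M : R), (0 < l)%R -> (0 < N)%R ->
  (1 < q <= 2)%R -> measurable_fun setT f -> (forall x, `|f x| <= M)%R ->
  (forall x, ~ cube c l x -> f x = 0%R) -> (\int[mu]_x f x = 0)%R ->
  \int[mu]_x (`|f x| `^ q)%:E <= (20 * N `^ q * l ^+ n)%:E ->
  \int[mu]_x `|T f x|%:E <= (C * (N * l ^+ n / (q - 1)))%:E.
Proof.
have [C C0 weak] := CZ_weakqq hT; have [A A0 far] := CZ_far.
pose K := (2 * (4 * n%:R) ^+ n + 80 * expR 1 * C + 21 * A)%R.
have K1 : (0 <= (4 * n%:R) ^+ n :> R)%R by rewrite exprn_ge0// mulr_ge0.
have e0 := @expR_gt0 R 1%R.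
have K2 : (0 < 80 * expR 1 * C)%R by rewrite !mulr_gt0.
exists K => [|f c l q N M l0 N0 /andP[q1 q2] mf fM f0 If fq].
  by rewrite /K; nra.
have f1 := bounded_cube_Lfun1 (ltW l0) mf fM f0.
have f2 : f \in Lfun mu 2%:E.
  by apply: Lfun2P => //; apply: (integral_bounded_cube (ltW l0) _ fM f0).
have mD : measurable (dilate c l) by exact: measurable_cube.
have XX : (N * l ^+ n <= N * l ^+ n / (q - 1))%R.
  by rewrite ler_peMr ?mulr_ge0 ?exprn_ge0 ?(ltW l0) ?(ltW N0)// invf_ge1; lra.
have NN : (N `^ (1 - q) * N `^ q = N)%R.
  by rewrite -powRD ?subrK ?powRr1 ?(ltW N0)// (gt_eqF N0) implybT.
have If1 : \int[mu]_x `|f x|%:E <= (21 * (N * l ^+ n))%:E.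
  apply: (le_trans (integral_cube_le_powR (ltW l0) N0 q1 mf f0)).
  have p0 : 0 <= (N `^ (1 - q))%:E by rewrite lee_fin powR_ge0.
  apply: (le_trans (leeD2l _ (lee_wpmul2l p0 fq))).
  rewrite -EFinM -EFinD lee_fin -[X in (_ + X)%R](_ : 20 * (N * l ^+ n) = _)%R; first lra.
  by rewrite -{1}NN; ring.
have ID : \int[mu]_(x in dilate c l) `|T f x|%:E <=
    ((2 * (4 * n%:R) ^+ n + 80 * expR 1 * C) * (N * l ^+ n / (q - 1)))%:E.
  have B0 : (0 <= C * (20 * N `^ q * l ^+ n))%R.
    by rewrite !mulr_ge0 ?powR_ge0 ?exprn_ge0// ltW.
  have q12 : (1 < q <= 2)%R by rewrite q1.
  apply: (le_trans (weak_integral_le (CZ_measurable hT f1) mD q12 N0 B0 _)).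
    move=> r r0; apply: (le_trans (weak _ f1 _ _ q12 r0)).
    have p0 : 0 <= (C * r `^ (- q))%:E by rewrite lee_fin mulr_ge0 ?powR_ge0 ?ltW.
    apply: (le_trans (lee_wpmul2l p0 fq)).
    by rewrite -EFinM lee_fin le_eqVlt; apply/orP; left; apply/eqP; ring.
  have volD : mu (dilate c l) = ((4 * n%:R * l) ^+ n)%:E.
    by apply: lebn_cube; rewrite !mulr_ge0// ltW.
  rewrite [X in _ * X + _]volD -EFinM -EFinD lee_fin.
  rewrite [in leRHS]mulrDl; apply: lerD.
    rewrite exprMn [leLHS](_ : _ = 2 * (4 * n%:R) ^+ n * (N * l ^+ n))%R; last by ring.
    by rewrite ler_wpM2l// mulr_ge0.
  rewrite le_eqVlt; apply/orP; left; apply/eqP.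
  transitivity (80 * expR 1 * C * (N `^ (1 - q) * N `^ q * l ^+ n / (q - 1)))%R.
    by field; rewrite subr_eq0 gt_eqF.
  by rewrite NN.
have IDC : \int[mu]_(x in ~` dilate c l) `|T f x|%:E <=
    (21 * A * (N * l ^+ n / (q - 1)))%:E.
  apply: (le_trans (far _ _ _ l0 f1 f2 f0 If)).
  have A0' : 0 <= A%:E by rewrite lee_fin ltW.
  apply: (le_trans (lee_wpmul2l A0' If1)).
  by rewrite -EFinM lee_fin mulrCA mulrA ler_wpM2l// mulr_ge0// ltW.
rewrite -(setUv (dilate c l)) ge0_integral_setU//.
- by rewrite /K [in leRHS]mulrDl EFinD; exact: leeD.
- exact: measurableC.
- rewrite setUv; apply/measurable_EFinP/measurableT_comp => //.
  exact: CZ_measurable.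
- exact/disj_setPCl.
Qed.

End molecules.

(** * Atoms *)

Section atoms.
Context (R : realType) (n : nat).
Local Notation mu := (lebn R n).
Implicit Types (c : Rn R n) (f a : Rn R n -> R) (l : R).
Local Open Scope ereal_scope.

(** The normalization of an atom says that N = p^(-1/s) / |Q| bounds the average
    of |a|^q to the power 1/q. *)
Lemma atom_powR_le (p q : R) (s : \bar R) a c l : (0 < l)%R -> (0 < p)%R -> (1 < q)%R ->
  atom_on p q s a c l ->
  [/\ measurable_fun setT a, forall x, ~ cube c l x -> a x = 0%R,
     (\int[mu]_x a x = 0)%R &
     \int[mu]_x (`|a x| `^ q)%:E <=
       ((p `^ (- fine s^-1) / l ^+ n) `^ q * l ^+ n)%:E].
Proof.
move=> l0 p0 q1 [ma supQ Ia aq].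
have a0 x : ~ cube c l x -> a x = 0%R.
  by move=> nQx; apply: contra_notP nQx => /eqP /supp_neq0; exact: supQ.
have ln0 : (0 < l ^+ n)%R by rewrite exprn_gt0.
have volE : fine (mu (cube c l)) = (l ^+ n)%R.
  by have -> : mu (cube c l) = (l ^+ n)%:E by apply: lebn_cube; exact: ltW.
have toT (F : R -> R) : F 0%R = 0%R ->
    \int[mu]_(x in cube c l) (F (a x))%:E = \int[mu]_x (F (a x))%:E.
  move=> F0; rewrite integral_mkcond; apply: eq_integral => x _.
  by rewrite patchE; case: ifPn => // /negP; rewrite inE => /a0 ->; rewrite F0.
split => //.
  by rewrite -[LHS](_ : (\int[mu]_(x in cube c l) a x = _)%R)// /Rintegral (toT id).
move: aq; rewrite volE (toT (fun y => `|y| `^ q)%R) ?normr0 ?powR0 ?gt_eqF ?(lt_trans ltr01)//.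
set I := \int[mu]_x _; set sg := fine _.
have I0 : 0 <= I by apply: integral_ge0 => x _; rewrite lee_fin powR_ge0.
have K0 : (0 < p `^ sg * l ^+ n)%R by rewrite mulr_gt0// powR_gt0.
rewrite muleC -lee_pdivlMr// mul1e => aq.
have q0 : (q != 0)%R by rewrite gt_eqF// (lt_trans ltr01).
have VI0 : 0 <= (l ^+ n)^-1%:E * I by rewrite mule_ge0// lee_fin invr_ge0 ltW.
have : ((l ^+ n)^-1%:E * I) <= ((p `^ sg * l ^+ n)^-1 `^ q)%:E.
  rewrite -[leLHS]poweRe1// -(mulVf q0) poweRrM -poweR_EFin.
  apply: gt0_ler_poweR => //; first by rewrite ltW// (lt_trans ltr01).
  - by rewrite in_itv/= leey poweR_ge0.
  - by rewrite in_itv/= leey lee_fin invr_ge0 ltW.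
by rewrite lee_pdivrMl// -EFinM mulrC powRN invfM.
Qed.

(** Cut f at a large height, then subtract the mean on the cube. That mean is at
    most 2 N in absolute value, whence the control of the L^q norm with the factor
    20 = 4 + 4 * 4, and it tends to the mean of f, which is 0, whence the
    approximation. *)
Lemma truncation f c l (q N : R) (e : R) : (0 < l)%R -> (0 < N)%R ->
  (1 < q <= 2)%R -> measurable_fun setT f ->
  (forall x, ~ cube c l x -> f x = 0%R) -> (\int[mu]_x f x = 0)%R ->
  \int[mu]_x (`|f x| `^ q)%:E <= (N `^ q * l ^+ n)%:E -> (0 < e)%R ->
  exists (b : Rn R n -> R) (M : R), [/\ measurable_fun setT b /\ (forall x, `|b x| <= M)%R,
    forall x, ~ cube c l x -> b x = 0%R, (\int[mu]_x b x = 0)%R,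
    \int[mu]_x (`|b x| `^ q)%:E <= (20 * N `^ q * l ^+ n)%:E &
    \int[mu]_x `|f x - b x|%:E <= e%:E].
Proof.
move=> l0 N0 /andP[q1 q2] mf f0 If fq e0.
have ln0 : (0 < l ^+ n)%R by rewrite exprn_gt0.
have f1 := integral_le_normalized l0 N0 q1 mf f0 fq.
have intf : mu.-integrable setT (EFin \o f).
  apply/integrableP; split; first exact/measurable_EFinP.
  by apply: le_lt_trans f1 _; exact: ltry.
pose fk (k : nat) x := (if `|f x| <= k%:R then f x else 0)%R.
have mfk k : measurable_fun setT (fk k).
  apply: measurable_fun_ifT => //; apply: measurable_fun_ler => //.
  exact: measurableT_comp.
have fk_le k x : (`|fk k x| <= `|f x|)%R.
  by rewrite /fk; case: ifP => // _; rewrite normr0.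
have intfk k : mu.-integrable setT (EFin \o fk k).
  apply: (le_integrable _ _ _ intf) => //; first exact/measurable_EFinP.
  by move=> x _ /=; rewrite lee_fin.
have cvg_fk x : fk ^~ x @ \oo --> f x.
  apply: cvg_near_cst; near=> k; rewrite /fk ifT//.
  by near: k; exact: nbhs_infty_ger.
have [k fke] : exists k, \int[mu]_x `|f x - fk k x|%:E <= (e / 2)%:E.
  have [_ cvg0 _] : [/\ mu.-integrable setT (EFin \o f),
      (fun k => \int[mu]_x `|(EFin \o fk k) x - (EFin \o f) x|) @ \oo --> 0 &
      (fun k => \int[mu]_x (EFin \o fk k) x) @ \oo --> \int[mu]_x (EFin \o f) x].
    apply: (@dominated_convergence _ _ _ mu setT measurableT _ _ (abse \o (EFin \o f))).
    - by move=> k; exact/measurable_EFinP.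
    - exact/measurable_EFinP.
    - by apply: aeW => x _; apply: cvg_EFin (cvg_fk x); exact: nearW.
    - exact: integrable_abse.
    - by apply: aeW => x k _; rewrite lee_fin.
  have [|k fke] := cvg0_ex_le cvg0 (e := (e / 2)%R); first by rewrite divr_gt0.
  exists k; apply: le_trans fke; rewrite le_eqVlt; apply/orP; left; apply/eqP.
  by apply: eq_integral => x _ /=; rewrite distrC.
have abs_le (g : Rn R n -> R) : mu.-integrable setT (EFin \o g) ->
    (`|\int[mu]_x g x|)%R%:E <= \int[mu]_x `|g x|%:E.
  move=> ig; rewrite EFin_normr_Rintegral//; apply: le_abse_integral => //.
  by case/integrableP : ig.
pose m := ((\int[mu]_x fk k x) / l ^+ n)%R.
have mV : (\int[mu]_x fk k x = m * l ^+ n)%R by rewrite divfK// gt_eqF.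
have m_e : (`|m| * l ^+ n <= e / 2)%R.
  rewrite -[X in (_ * X)%R]gtr0_norm// -normrM -mV -lee_fin.
  have -> : (\int[mu]_x fk k x = \int[mu]_x (fk k x - f x))%R.
    by rewrite RintegralB// If subr0.
  apply: le_trans fke; apply: le_trans (abs_le _ _) _.
    rewrite (_ : _ \o _ = (EFin \o fk k) \- (EFin \o f)) ; last exact/funext.
    exact: integrableB.
  rewrite le_eqVlt; apply/orP; left; apply/eqP; apply: eq_integral => x _.
  by rewrite distrC.
have m_N : (`|m| <= 2 * N)%R.
  rewrite -(ler_pM2r ln0) -[X in (_ * X <= _)%R]gtr0_norm// -normrM -mV -mulrA.
  rewrite -lee_fin; apply: le_trans f1; apply: le_trans (abs_le _ (intfk k)) _.
  by apply: le_integral_nonmeasurable => x _; rewrite !lee_fin normr_ge0/=.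
have mQ : measurable (cube c l) by exact: measurable_cube.
have m1 := measurable_indic mQ.
have I1 := integral_indic_cube c (ltW l0).
pose b x := (fk k x - m * \1_(cube c l) x)%R.
have int1 : mu.-integrable setT (EFin \o \1_(cube c l)).
  apply/integrableP; split; first exact/measurable_EFinP.
  rewrite (eq_integral (fun x => (\1_(cube c l) x)%:E)) => [|x _].
    by rewrite I1 ltry.
  by rewrite /= ger0_norm.
have intm : mu.-integrable setT (EFin \o (fun x => m * \1_(cube c l) x)%R).
  exact: (integrableZl measurableT m int1).
have indic_le x : (0 <= (\1_(cube c l) x : R) <= 1)%R.
  by rewrite indicE; case: (_ \in _); rewrite ?lexx ?ler01.
exists b, (k%:R + `|m|)%R; split.
- split; first by apply: measurable_funB => //; exact: measurable_funM.
  move=> x; apply: (le_trans (ler_normB _ _)); apply: lerD.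
    by rewrite /fk; case: ifP => // _; rewrite normr0.
  by rewrite normrM ler_piMr//; case/andP : (indic_le x) => ? ?; rewrite ger0_norm.
- move=> x nQx; rewrite /b /fk f0// normr0 ler0n indicE memNset// mulr0 subr0//.
- rewrite RintegralB// mV RintegralZl// /Rintegral I1/= subrr//.
- apply: (@le_trans _ _ (4%:E * \int[mu]_x (`|f x| `^ q)%:E +
      (16 * N `^ q)%:E * \int[mu]_x (\1_(cube c l) x)%:E)).
    have q0 : (0 <= q)%R by lra.
    have mq := measurable_normr_powR q mf.
    rewrite -!ge0_integralZl//; last 3 first.
    - exact/measurable_EFinP.
    - by rewrite lee_fin mulr_ge0// powR_ge0.
    - exact/measurable_EFinP.
    rewrite -ge0_integralD//; last 3 first.
    - exact/measurable_funeM/measurable_EFinP.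
    - by move=> x _; rewrite mule_ge0 ?lee_fin ?mulr_ge0 ?powR_ge0.
    - exact/measurable_funeM/measurable_EFinP.
    apply: le_integral_nonmeasurable => x _; rewrite lee_fin powR_ge0/=.
    rewrite -!EFinM -EFinD lee_fin /b.
    have [xQ|xQ] := pselect (cube c l x); last first.
      have -> : fk k x = 0%R by rewrite /fk f0// if_same.
      by rewrite indicE memNset// !mulr0 subrr normr0 powR0 ?addr0 ?mulr_ge0 ?powR_ge0 ?gt_eqF//; lra.
    rewrite indicE mem_set// !mulr1.
    have h1 : (`|fk k x - m| <= `|f x| + 2 * N)%R.
      by rewrite (le_trans (ler_normB _ _))// lerD.
    have two_q : (2 `^ q <= 4 :> R)%R.
      have -> : (4 = 2 `^ 2 :> R)%R by rewrite powR_mulrn//; lra.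
      by apply: ler_powR => //; lra.
    have max_q (u v : R) : (0 <= u)%R -> (0 <= v)%R ->
        ((u + v) `^ q <= 4 * u `^ q + 4 * v `^ q)%R.
      move=> u0 v0; wlog uv : u v u0 v0 / (u <= v)%R.
        move=> H; have [uv|/ltW vu] := leP u v; first exact: H.
        by rewrite addrC [leRHS]addrC; exact: H.
      apply: (@le_trans _ _ ((2 * v) `^ q)%R).
        by apply: ge0_ler_powR; rewrite ?nnegrE ?addr_ge0 ?mulr_ge0//; lra.
      rewrite powRM// ler_wpDl ?mulr_ge0 ?powR_ge0//.
      by rewrite ler_wpM2r// powR_ge0.
    have N2q : ((2 * N) `^ q <= 4 * N `^ q)%R.
      by rewrite powRM ?(ltW N0)// ler_wpM2r// powR_ge0.
    apply: (@le_trans _ _ ((`|f x| + 2 * N) `^ q)%R).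
      by apply: ge0_ler_powR; rewrite ?nnegrE ?addr_ge0 ?mulr_ge0 ?(ltW N0).
    apply: (le_trans (max_q _ _ _ _)) => //; first by rewrite mulr_ge0 ?(ltW N0).
    by lra.
  rewrite I1; apply: (le_trans (leeD2r _ (lee_wpmul2l _ fq))); first by rewrite lee_fin.
  by rewrite -!EFinM -EFinD lee_fin; lra.
- apply: (@le_trans _ _ (\int[mu]_x `|f x - fk k x|%:E +
      `|m|%:E * \int[mu]_x (\1_(cube c l) x)%:E)).
    rewrite -ge0_integralZl//; last by exact/measurable_EFinP.
    rewrite -ge0_integralD//; last 2 first.
    - apply/measurable_EFinP; apply: measurableT_comp => //.
      exact: measurable_funB.
    - exact/measurable_funeM/measurable_EFinP.
    apply: le_integral_nonmeasurable => x _; rewrite lee_fin normr_ge0/=.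
    rewrite -EFinM -EFinD lee_fin /b opprB addrCA addrC.
    rewrite (le_trans (ler_normD _ _))// lerD2l normrM ler_wpM2l//.
    by rewrite ger0_norm//; case/andP : (indic_le x).
  rewrite I1 -EFinM; apply: (le_trans (leeD fke (y:=(e / 2)%:E) _)).
    by rewrite lee_fin.
  by rewrite -EFinD lee_fin; lra.
Unshelve. all: by end_near.
Qed.

End atoms.

(** * Splitting a function of X_s *)

Section splitting.
Context (R : realType) (n : nat) (hn : (0 < n)%N).
Local Notation mu := (lebn R n).
Context (T : (Rn R n -> R) -> Rn R n -> R) (hT : CZ_operator T).
Local Open Scope ereal_scope.

(** Let X = p^(1/s), so that the atom has L^1 norm at most 2/X. If 1/X <= dl,
    then b = 0 will do. Otherwise b is a truncation of the atom and T b has L^1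
    norm at most C p/X = C X^(s-1), where X < 1/dl. *)
Lemma atom_split (s : R) : (1 < s)%R -> exists2 C : R, (0 < C)%R &
  forall a, atom s%:E a -> forall dl : R, (0 < dl)%R ->
  exists b, [/\ a \in Lfun mu 1, b \in Lfun mu 1,
    \int[mu]_x `|a x - b x|%:E <= (2 * dl)%:E &
    \int[mu]_x `|T b x|%:E <= (C * dl `^ (1 - s))%:E].
Proof.
move=> s1; have [C C0 mol] := CZ_molecule hn hT; exists C => // a.
move=> [p [q [/andP[q1 q2] pq [c [l [l0 at_]]]]]] dl dl0.
have s0 : (0 < s)%R by lra.
have q0 : (0 < q)%R by lra.
have pVE : (p^-1 = (q - 1) / q)%R by rewrite mulrBl divff ?gt_eqF// mul1r -pq addrK.
have p0 : (0 < p)%R by rewrite -invr_gt0 pVE divr_gt0 ?subr_gt0.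
have q1p : ((q - 1)^-1 <= p)%R.
  by rewrite -[p]invrK pVE invf_div ler_peMl ?(ltW q1)// invr_ge0 subr_ge0 ltW.
have [ma a0 Ia aq] := atom_powR_le l0 p0 q1 at_.
move: aq; rewrite inver gt_eqF//=; set X := (p `^ s^-1)%R => aq.
have X0 : (0 < X)%R by rewrite powR_gt0.
have XsE : (p = X `^ s)%R by rewrite /X -powRrM mulVf ?gt_eqF// powRr1// ltW.
pose N := (X^-1 / l ^+ n)%R.
have ln0 : (0 < l ^+ n)%R by rewrite exprn_gt0.
have NE : (N * l ^+ n = X^-1)%R by rewrite divfK// gt_eqF.
have N0 : (0 < N)%R by rewrite divr_gt0// invr_gt0.
rewrite powRN -/X -/N in aq.
have a1 := integral_le_normalized l0 N0 q1 ma a0 aq.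
have aL : a \in Lfun mu 1 by apply: Lfun1P => //; exact: le_lt_trans a1 (ltry _).
have [Xdl|dlX] := leP X^-1%R dl.
  exists (fun=> 0%R); split => //.
  - exact: Lfun1_cst0.
  - under eq_integral do rewrite subr0.
    by apply: (le_trans a1); rewrite NE lee_fin ler_wpM2l.
  - by rewrite (CZ0 hT) lee_fin mulr_ge0 ?powR_ge0 ?ltW.
have q12 : (1 < q <= 2)%R by rewrite q1.
have dl20 : (0 < 2 * dl)%R by rewrite mulr_gt0.
have [b [M [[mb bM] b0 Ib bq ab]]] := truncation l0 N0 q12 ma a0 Ia aq dl20.
have bL := bounded_cube_Lfun1 (ltW l0) mb bM b0.
exists b; split => //; apply: (le_trans (mol _ _ _ _ _ _ l0 N0 q12 mb bM b0 Ib bq)).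
rewrite NE lee_fin ler_wpM2l ?(ltW C0)//.
apply: (@le_trans _ _ (X^-1 * p)%R); first by rewrite ler_wpM2l// invr_ge0 ltW.
have -> : (X^-1 * p = X `^ (s - 1))%R.
  by rewrite XsE powRD ?(gt_eqF X0) ?implybT// powRN powRr1 ?(ltW X0)// mulrC.
have -> : (dl `^ (1 - s) = dl^-1 `^ (s - 1))%R.
  by rewrite -(powR_inv1 (ltW dl0)) -powRrM mulN1r opprB.
apply: ge0_ler_powR; rewrite ?nnegrE ?invr_ge0 ?subr_ge0 ?(ltW s1) ?(ltW X0) ?(ltW dl0)//.
by rewrite -[X]invrK lef_pV2 ?posrE ?invr_gt0// ltW.
Qed.

(** A finite partial sum of the atomic decomposition, with each atom split at
    the same dl: finite sums suffice as the tail of the series is small in L^1. *)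
Lemma Xs_split (s : R) f : (1 < s)%R -> Xs s%:E f ->
  exists2 C : R, (0 < C)%R & forall dl : R, (0 < dl)%R ->
  exists f1, [/\ f1 \in Lfun mu 1,
    \int[mu]_x `|f x - f1 x|%:E <= (C * dl)%:E &
    \int[mu]_x `|T f1 x|%:E <= (C * dl `^ (1 - s))%:E].
Proof.
move=> s1 [fL [lam [a [at_ lam_fin fa]]]].
have [C C0 split_atom] := atom_split s1.
have L0 : 0 <= \sum_(0 <= j <oo) `|lam j|%:E by apply: nneseries_ge0.
pose L := fine (\sum_(0 <= j <oo) `|lam j|%:E).
have LE : \sum_(0 <= j <oo) `|lam j|%:E = L%:E by rewrite fineK// ge0_fin_numE.
have {}L0 : (0 <= L)%R by rewrite fine_ge0.
have lamL N : (\sum_(j < N) `|lam j| <= L)%R.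
  rewrite -lee_fin -LE -sumEFin -(big_mkord xpredT (fun j => `|lam j|%:E)).
  by apply: nneseries_lim_ge => j _ _; rewrite lee_fin.
(* the tail, the errors of the truncations, and the image under T *)
exists (1 + 2 * L + C * L)%R => [|dl dl0].
  by rewrite -addrA ltr_wpDr// addr_ge0// mulr_ge0// ltW.
pose b j := sval (cid (split_atom _ (at_ j) dl dl0)).
have aL j : a j \in Lfun mu 1 by have [b' []] := split_atom _ (at_ j) dl dl0.
have bL j : b j \in Lfun mu 1 by rewrite /b; case: cid => ? [].
have ab j : \int[mu]_x `|a j x - b j x|%:E <= (2 * dl)%:E.
  by rewrite /b; case: cid => ? [].
have Tb j : \int[mu]_x `|T (b j) x|%:E <= (C * dl `^ (1 - s))%:E.
  by rewrite /b; case: cid => ? [].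
clearbody b.
pose FN (N : nat) x := (\sum_(j < N) lam j * a j x)%R.
pose GN (N : nat) x := (\sum_(j < N) lam j * b j x)%R.
have FG N : [/\ GN N \in Lfun mu 1, FN N \in Lfun mu 1,
    \int[mu]_x `|FN N x - GN N x|%:E <= ((\sum_(j < N) `|lam j|) * (2 * dl))%:E &
    \int[mu]_x `|T (GN N) x|%:E <= ((\sum_(j < N) `|lam j|) * (C * dl `^ (1 - s)))%:E].
  elim: N => [|N [GL FL FGN TG]].
    have -> : GN 0%N = fun=> 0%R by apply/funext => x; rewrite /GN big_ord0.
    have -> : FN 0%N = fun=> 0%R by apply/funext => x; rewrite /FN big_ord0.
    rewrite big_ord0 !mul0r (CZ0 hT); have L0' := Lfun1_cst0 mu; split => //.
    by rewrite integral0_eq// => x _; rewrite subrr normr0.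
  have GS : GN N.+1 = (fun x => lam N * b N x + GN N x)%R.
    by apply/funext => x; rewrite /GN big_ord_recr/= addrC.
  have FS : FN N.+1 = (fun x => lam N * a N x + FN N x)%R.
    by apply/funext => x; rewrite /FN big_ord_recr/= addrC.
  have comb (f1 g1 : Rn R n -> R) : f1 \in Lfun mu 1 -> g1 \in Lfun mu 1 ->
      (fun x => lam N * f1 x + g1 x)%R \in Lfun mu 1.
    move=> /Lfun1_integrable i1 /Lfun1_integrable i2; apply/Lfun1_integrable.
    rewrite (_ : _ \o _ = fun x => (lam N)%:E * (f1 x)%:E + (g1 x)%:E)//.
    exact: integrableD (integrableZl _ (lam N) i1) i2.
  have GL' : GN N.+1 \in Lfun mu 1 by rewrite GS; exact: comb.
  have FL' : FN N.+1 \in Lfun mu 1 by rewrite FS; exact: comb.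
  split => //.
  - have FGE : (fun x => FN N.+1 x - GN N.+1 x)%R =
        (fun x => lam N * (a N x - b N x) + (FN N x - GN N x))%R %[ae mu].
      by apply: aeW => x _; rewrite FS GS; ring.
    apply: (le_trans (integral_comb_le _ _ _ FGE (ab N) FGN)).
    + by apply: measurable_funB; exact: Lfun1_mfun.
    + exact: (measurable_funB (Lfun1_mfun FL) (Lfun1_mfun GL)).
    + exact: (measurable_funB (Lfun1_mfun FL') (Lfun1_mfun GL')).
    + by rewrite -EFinM -EFinD lee_fin big_ord_recr/= [leRHS]mulrDl [leLHS]addrC lexx.
  - apply: (le_trans (integral_comb_le _ _ _ (CZ_linear hT (bL N) GL GS) (Tb N) TG)).
    + exact: CZ_measurable.
    + exact: CZ_measurable.
    + exact: CZ_measurable.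
    + by rewrite -EFinM -EFinD lee_fin big_ord_recr/= [leRHS]mulrDl [leLHS]addrC lexx.
have [N fN] : exists N, \int[mu]_x `|f x - FN N x|%:E <= dl%:E.
  have [//|N fN] := cvg0_ex_le fa (e := dl).
  by exists N; move: fN; rewrite Lnorm1.
have [GL FL FGN TG] := FG N.
exists (GN N); split => //.
- have fGE : (fun x => f x - GN N x)%R =
      (fun x => 1 * (f x - FN N x) + (FN N x - GN N x))%R %[ae mu].
    by apply: aeW => x _; ring.
  apply: (le_trans (integral_comb_le _ _ _ fGE fN FGN)).
  + exact: (measurable_funB (Lfun1_mfun fL) (Lfun1_mfun FL)).
  + exact: (measurable_funB (Lfun1_mfun FL) (Lfun1_mfun GL)).
  + exact: (measurable_funB (Lfun1_mfun fL) (Lfun1_mfun GL)).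
  rewrite normr1 mul1e -EFinD lee_fin.
  have := ler_wpM2r (ltW dl0) (lamL N); have : (0 <= C * L * dl)%R.
    by rewrite !mulr_ge0// ltW.
  by lra.
- apply: (le_trans TG); rewrite lee_fin mulrA ler_wpM2r ?powR_ge0//.
  rewrite mulrC; apply: (@le_trans _ _ (C * L)%R); first by rewrite ler_wpM2l// ltW.
  by rewrite lerDr addr_ge0// mulr_ge0.
Qed.

End splitting.

Theorem mainTheorem4 (R : realType) (n : nat) (hn : (0 < n)%N)
    (T : (Rn R n -> R) -> Rn R n -> R) (hT : CZ_operator T)
    (s r : \bar R) (hs : (1 < s)%E) (hsr : (s < r)%E)
    (f : Rn R n -> R) (hf : Xs s f) :
  Lorentz1 r (T f).
Proof.
have fL : f \in Lfun (lebn R n) 1 by case: hf.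
split; first exact: CZ_measurable.
pose mu := lebn R n; pose i := fine (\int[mu]_x `|f x|%:E)%E.
have i0 : 0 <= i by rewrite fine_ge0// integral_ge0.
have iE : (i%:E = \int[mu]_x `|f x|%:E)%E.
  by rewrite fineK// ge0_fin_numE ?integral_ge0//; exact: Lfun1_lty.
case: r hsr => [r|_|]; last 2 first.
- case: hT => _ _ _ _ [C bC]; have [_ Tf] := bC _ fL.
  by apply: (le_lt_trans Tf); rewrite Lnorm1 -iE -EFinM ltry.
- by rewrite ltNge leNye.
case: s hs hf => // s; rewrite !lte_fin => s1 hf sr.
have [C C0 fsplit] := Xs_split hn hT s1 hf.
have [C1 C10 weak] := CZ_weak11 hT.
have K0 : (0 < 4 * C1 * C)%R by rewrite !mulr_gt0.
have M0 : (0 < C1 * i + 1)%R by rewrite ltr_wpDl// mulr_ge0// ltW.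
have C'0 : (0 <= C * (4 * C1 * C)^-1 `^ (1 - s))%R by rewrite mulr_ge0 ?powR_ge0 ?ltW.
apply: (lorentz1_lty s1 sr M0 C'0) => [l l0|a a0].
  apply: (le_trans (weak _ fL _ l0)); rewrite -iE -EFinM lee_fin mulrAC.
  by rewrite ler_wpM2r ?invr_ge0 ?(ltW l0)// lerDl.
(* the value for which the weak bound on T (f - f1) at height l / 2 is a / (2 l) *)
have [f1 [f1L ff1 Tf1]] := fsplit (a / (4 * C1 * C))%R (divr_gt0 a0 K0).
have f2L : (fun x => f x - f1 x)%R \in Lfun mu 1.
  apply: Lfun1P; last exact: le_lt_trans ff1 (ltry _).
  exact: (measurable_funB (Lfun1_mfun fL) (Lfun1_mfun f1L)).
exists (T f1); split; first exact: CZ_measurable.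
  apply: (le_trans Tf1); rewrite powRM ?invr_ge0 ?(ltW a0) ?(ltW K0)//.
  by rewrite mulrA mulrAC.
move=> l l0; have l20 : (0 < l / 2)%R by rewrite divr_gt0.
have fE : f = (fun x => 1 * f1 x + (f x - f1 x))%R.
  by apply/funext => x; ring.
have TfE : T f = (fun x => T f1 x + T (fun x => f x - f1 x) x)%R %[ae mu].
  have := CZ_linear hT f1L f2L fE.
  by apply: filterS => x /= + xT => /(_ xT) ->; rewrite mul1r.
apply: (le_trans (level_add l _ _ _ TfE)); [exact: CZ_measurable..|].
rewrite leeD2l//; apply: (le_trans (weak _ f2L _ l20)).
have c0 : (0 <= (C1 / (l / 2))%:E)%E by rewrite lee_fin divr_ge0 ?ltW.
apply: (le_trans (lee_wpmul2l c0 ff1)).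
rewrite -EFinM lee_fin le_eqVlt; apply/orP; left; apply/eqP.
by field; rewrite !gt_eqF.
Qed.
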